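(* Let $n\ge2$, $f$ a smooth positive function and $g=-f(r)\,dt^2+f(r)^{-1}dr^2+d\omega_{n-1}^2$. Introduce $x$ by $r=-\tan(x-\pi/2)$, with $x\in(0,x_0)$ for a constant $0<x_0<\pi/2$, and set $M=\mathbb R\times(0,x_0)\times S^{n-1}$ (coordinates $t,x,\omega$), $F(x)=f(r(x))$, $\Omega(x)=F(x)^{-1/2}$, $G(x)=\csc^2(x)/F(x)$, $a(x)=\sqrt{F(x)}\sin^2 x$, so that $g=\Omega^{-2}\overline g$ with $\overline g=-dt^2+G(x)^2\big(dx^2+a(x)^2d\omega_{n-1}^2\big)$. Let $b(x)=\exp\big(\int_{x_0}^x a(s)^{-1}ds\big)$ and let $\overline M=\mathbb R\times\{y\in\mathbb R^n:|y|<1\}$, in which $M$ is identified with $\{y\neq0\}$ via $y=b(x)\omega$ ($\omega\in S^{n-1}\subset\mathbb R^n$), and let $\mathcal J=\mathbb R\times\{0\}$ (the locus $x=0$). Suppose $a$ is smooth and $a(x)=x+O(x^2)$, $a'(x)=1+O(x)$ as $x\to0$. Then: $\overline g$ extends to a Lipschitz Lorentzian metric on $\overline M$ for which $\mathcal J$ is a smooth inextendible timelike curve with $\partial M=\mathcal J$; $\Omega$ extends continuously to $\overline M$ with $\Omega=0$ on $\mathcal J$, $\Omega>0$ smooth on $M$, and $d\Omega$ is bounded on a neighbourhood of $\mathcal J$ minus $\mathcal J$; and $\overline g=\Omega^2 g$ on $M$. (That is, conditions (ii), (iii), (iv) of the definition of asymptotically $\mathrm{AdS}_2\times S^{n-1}$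 ends hold with $\mathcal J$ given by $x=0$.)
   Context: Here $d\omega_{n-1}^2$ is the round unit metric on $S^{n-1}$. The definition referred to: a smooth spacetime $(M,g)$ has asymptotically $\mathrm{AdS}_2\times S^{n-1}$ ends if there exist $(\overline M,\overline g)$ with locally Lipschitz Lorentzian $\overline g$ and $\Omega\in C^{0,1}(\overline M)$ with (i) $(\overline M,\overline g)$ globally hyperbolic; (ii) $M\subset\overline M$ and $\partial M=\mathcal J$ a disjoint union of smooth inextendible timelike curves; (iii) $\Omega|_M$ smooth, $\Omega>0$ on $M$, $\Omega=0$ on $\mathcal J$, each point of $\mathcal J$ has a neighborhood $U$ with $U\cap\mathcal J$ connected and $d\Omega$ bounded on $U\setminus\mathcal J$; (iv) $\overline g=\Omega^2g$ on $M$. *)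

(* Defs.v *)
From HB Require Import structures.
From mathcomp Require Import all_boot all_order all_algebra.
From mathcomp Require Import all_classical all_reals all_analysis.
Set Implicit Arguments. Unset Strict Implicit. Unset Printing Implicit Defensive.
Import Order.TTheory GRing.Theory Num.Theory.
Import numFieldNormedType.Exports.
Local Open Scope classical_set_scope.
Local Open Scope ring_scope.

Section Defs.
Variable R : realType.

Definition iterD {V W : normedModType R} (vs : seq V) (f : V -> W) : V -> W :=
  foldr (fun v g => 'D_v g) f vs.

Definition smooth_on {V W : normedModType R} (U : set V) (f : V -> W) : Prop :=
  forall (vs : seq V) (p : V), U p -> differentiable (iterD vs f) p.

Definition loc_lipschitz_on {V W : normedModType R} (A : set V) (f : V -> W)
  : Prop :=
  forall p, A p -> exists2 U, nbhs p U &
    exists L : R, forall q r, U q -> A q -> U r -> A r ->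
      `| f q - f r | <= L * `| q - r |.

Definition edot (n : nat) (u v : 'rV[R]_n) : R := (u *m v^T) 0 0.
Definition esq (n : nat) (u : 'rV[R]_n) : R := edot u u.

Definition qform (m : nat) (A : 'M[R]_m) (v : 'rV[R]_m) : R := (v *m A *m v^T) 0 0.

Definition lorentzian (m : nat) (A : 'M[R]_m) : Prop :=
  A^T = A /\
  exists2 P : 'M[R]_m, P \in unitmx &
    P^T *m A *m P = diag_mx (\row_(i < m) (if val i == 0%N then -1 else 1)).

Definition pt (n : nat) (t : R) (y : 'rV[R]_n) : 'rV[R]_(1 + n) :=
  row_mx (\row_(i < 1) t) y.
Definition ycoord (n : nat) (p : 'rV[R]_(1 + n)) : 'rV[R]_n := rsubmx p.

Definition Mbar (n : nat) : set 'rV[R]_(1 + n) := [set p | esq (ycoord p) < 1].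
Definition Mset (n : nat) : set 'rV[R]_(1 + n) :=
  [set p | 0 < esq (ycoord p) < 1].
Definition Jset (n : nat) : set 'rV[R]_(1 + n) := [set p | ycoord p = 0].

Definition Jcurve (n : nat) (t : R) : 'rV[R]_(1 + n) := pt t 0.
Definition inextendible_in (n : nat) (A : set 'rV[R]_(1 + n))
  (gam : R -> 'rV[R]_(1 + n)) : Prop :=
  forall p, A p -> ~ (gam @ +oo --> p) /\ ~ (gam @ -oo --> p).

Definition rfun (x : R) : R := - tan (x - pi / 2).
Definition Ffun (f : R -> R) (x : R) : R := f (rfun x).
Definition Omfun (f : R -> R) (x : R) : R := (Num.sqrt (Ffun f x))^-1.
Definition Gfun (f : R -> R) (x : R) : R := (sin x ^+ 2)^-1 / Ffun f x.
Definition afun (f : R -> R) (x : R) : R := Num.sqrt (Ffun f x) * sin x ^+ 2.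
(* b(x) = exp( int_{x0}^x a(s)^-1 ds ) = exp( - int_[x, x0] a^-1 ), x <= x0 *)
Definition bfun (f : R -> R) (x0 x : R) : R :=
  expR (- \int[lebesgue_measure]_(s in `[x, x0]) (afun f s)^-1).

(* identification of M = R x (0,x0) x S^{n-1} with {y <> 0}: y = b(x) w *)
Definition Phi (n : nat) (f : R -> R) (x0 t x : R) (w : 'rV[R]_n)
  : 'rV[R]_(1 + n) := pt t (bfun f x0 x *: w).
(* its differential applied to the tangent vector (tau, xi, eta), eta _|_ w *)
Definition dPhi (n : nat) (f : R -> R) (x0 t x : R) (w : 'rV[R]_n)
  (tau xi : R) (eta : 'rV[R]_n) : 'rV[R]_(1 + n) :=
  pt tau ((derive1 (bfun f x0) x * xi) *: w + bfun f x0 x *: eta).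

Definition gbar_coord (n : nat) (f : R -> R) (x : R)
  (tau xi : R) (eta : 'rV[R]_n) : R :=
  - tau ^+ 2 + Gfun f x ^+ 2 * (xi ^+ 2 + afun f x ^+ 2 * esq eta).
Definition g_coord (n : nat) (f : R -> R) (x : R)
  (tau xi : R) (eta : 'rV[R]_n) : R :=
  - Ffun f x * tau ^+ 2 + (Ffun f x)^-1 * (derive1 rfun x * xi) ^+ 2 + esq eta.

End Defs.

(* Main.v *)
(** In the coordinates [(t, y)], with [y = b(x) w] and [b' = b / a], one has
    [|dy|^2 = (b / a)^2 (dx^2 + a^2 dw^2)], so [gbar = -dt^2 + h^2 |dy|^2] with
    [h = Omega / b = sin^2 x / (a b)].  Since [a = x + O(x^2)], [(ln b - ln x)' =
    1/a - 1/x] is bounded, so [b] is comparable with [x] near [0].  Moreover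
    [(ln h)' = (2 a cot x - a' - 1) / a], whose numerator is [O(x) = O(b)], hence
    [|(ln h)'| <= L b'] away from [x = x0]: [ln h] is a Lipschitz function [K] of
    [|y| = b(x)], extends to [y = 0], and both [gbar] (through [h = exp K]) and
    [Omega = |y| exp (K |y|)] are locally Lipschitz across [J].  The Lipschitz
    bound on [Omega] is also the bound on its differential. *)
Require Import Defs.
From HB Require Import structures.
From mathcomp Require Import all_boot all_order all_algebra.
From mathcomp Require Import all_classical all_reals all_analysis.
From mathcomp Require Import ring lra.
Set Implicit Arguments. Unset Strict Implicit. Unset Printing Implicit Defensive.
Import Order.TTheory GRing.Theory Num.Theory.
Import numFieldNormedType.Exports.
Local Open Scope classical_set_scope.
Local Open Scope ring_scope.

(** The obstacle is the axis. The hypotheses control [a] only to first order at [0], so [h] need not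
    be differentiable at [y = 0] and has no explicit value there: a differential inequality gives
    Lipschitz regularity in [|y|], and the axis value comes from an extension. In [ln h] the
    function [b] enters the derivative only through [b' / b = 1 / a]; moreover the extended [h],
    being an exponential, stays positive on [J], which keeps the metric Lorentzian there. At the
    outer end [a] is assumed smooth on the open interval only, so Lipschitz constants are sought on
    [|y| <= r1] for each [r1 < 1]. Smoothness of [Omega] on [M] is a separate problem, since [b] has
    no explicit inverse and [smooth_on] involves all iterated directional derivatives. The answer is
    a class of functions on [M] that contains [Omega] and is stable under every ['D_v]. *)

(** * Derivative rules and monotonicity *)

Section PointwiseDerivatives.
Context {R : realType} {V : normedModType R}.
Implicit Types (f g : V -> R) (x v : V).

Lemma is_derive_add f g x v df dg : is_derive x v f df -> is_derive x v g dg ->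
  is_derive x v (fun y => f y + g y) (df + dg).
Proof. by move=> hf hg; exact: is_deriveD. Qed.

Lemma is_derive_const (c : R) x v : is_derive x v (fun=> c) 0.
Proof. by apply: DeriveDef; [exact: derivable_cst|exact: derive_cst]. Qed.

Lemma is_derive_sub f g x v df dg : is_derive x v f df -> is_derive x v g dg ->
  is_derive x v (fun y => f y - g y) (df - dg).
Proof. by move=> hf hg; exact: is_deriveB. Qed.

Lemma is_derive_mul f g x v df dg : is_derive x v f df -> is_derive x v g dg ->
  is_derive x v (fun y => f y * g y) (f x * dg + g x * df).
Proof. by move=> hf hg; exact: is_deriveM. Qed.

Lemma is_derive_scale (c : R) f x v df : is_derive x v f df ->
  is_derive x v (fun y => c * f y) (c * df).
Proof. by move=> hf; exact: is_deriveZ. Qed.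

(** The composition goes through differentials: [phi], defined on the line, is differentiable as
    soon as it is derivable, whereas [f] has to be assumed so. *)
Lemma is_derive_chain (phi : R -> R) f x v dphi df :
  is_derive (f x) 1 phi dphi -> differentiable f x -> is_derive x v f df ->
  is_derive x v (phi \o f) (dphi * df).
Proof.
move=> [dp <-] dfx [_ <-].
have dp' : differentiable phi (f x) by apply/derivable1_diffP.
have dc : differentiable (phi \o f) x by apply: differentiable_comp.
apply: DeriveDef; first exact: diff_derivable.
rewrite !deriveE// diff_comp//= -{1}['d f x v]mulr1.
by rewrite -[_ * 1]/('d f x v *: (1 : R)) linearZ /= mulrC.
Qed.

End PointwiseDerivatives.

Section PointwiseDerivatives1.
Context {R : realType}.
Implicit Types (f g : R -> R) (x : R).

Lemma is_derive1_chain (phi f : R -> R) x dphi df :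
  is_derive (f x) 1 phi dphi -> is_derive x 1 f df ->
  is_derive x 1 (fun y => phi (f y)) (dphi * df).
Proof.
move=> hp hf; apply: is_derive_chain => //.
by apply/derivable1_diffP; case: hf.
Qed.

Lemma is_derive1_continuous f x df : is_derive x 1 f df -> {for x, continuous f}.
Proof.
by move=> [h _]; apply: differentiable_continuous; apply/derivable1_diffP.
Qed.

(** The tool behind all later comparisons: an estimate [|l'| <= m'] is used as monotonicity of
    [m + l] and [m - l]. *)
Lemma is_derive1_le f df (a b : R) : a <= b ->
  (forall x, a <= x <= b -> is_derive x 1 f (df x)) ->
  (forall x, a <= x <= b -> 0 <= df x) -> f a <= f b.
Proof.
move=> ab hf h0.
have hd x : x \in `]a, b[ -> is_derive x 1 f (df x).
  by move=> xab; apply: hf; rewrite !ltW// (itvP xab).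
have [|c] := MVT_segment ab hd.
  apply: continuous_in_subspaceT => x /set_mem /=; rewrite in_itv /= => hx.
  by have := hf x hx; exact: is_derive1_continuous.
rewrite in_itv /= => hc; rewrite -subr_ge0 => ->.
by rewrite mulr_ge0 ?h0 ?subr_ge0.
Qed.

End PointwiseDerivatives1.

(** * The factor [b] as the exponential of an integral *)

Section IntegralFactor.
Context {R : realType}.
Variables (a : R -> R) (x0 : R).
Hypothesis a_gt0 : forall x, 0 < x <= x0 -> 0 < a x.
Hypothesis a_cont : forall x, 0 < x <= x0 -> {for x, continuous a}.

Let mu := @lebesgue_measure R.
Let b x := expR (- \int[mu]_(s in `[x, x0]) (a s)^-1).

Let inva_cont x : 0 < x <= x0 -> {for x, continuous (fun s => (a s)^-1)}.
Proof.
by move=> hx; apply: continuousV; [rewrite gt_eqF ?a_gt0|exact: a_cont].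
Qed.

Let inva_int c : 0 < c -> mu.-integrable `[c, x0] (EFin \o (fun s => (a s)^-1)).
Proof.
move=> c0; apply: continuous_compact_integrable; first exact: segment_compact.
apply: continuous_in_subspaceT => x /set_mem /=; rewrite in_itv /= => /andP[cx xx].
by apply: inva_cont; rewrite (lt_le_trans c0).
Qed.

(** Trades the variable lower endpoint for a variable upper one, the form handled by the fundamental
    theorem of calculus. *)
Let splitE c x : 0 < c -> c <= x -> x <= x0 ->
  \int[mu]_(s in `[x, x0]) (a s)^-1 =
  \int[mu]_(s in `[c, x0]) (a s)^-1 - \int[mu]_(s in `[c, x]) (a s)^-1.
Proof.
move=> c0 cx xx; rewrite (@Rintegral_itvB _ _ (BLeft c) (BRight x0) x)//.
  rewrite Rintegral_itv_obnd_cbnd//.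
  apply: integrableS (inva_int c0) => //.
  by apply: subset_itv; rewrite bnd_simp.
exact: inva_int.
Qed.

Lemma integral_factor_end : b x0 = 1.
Proof. by rewrite /b set_itv1 Rintegral_set1 oppr0 expR0. Qed.

(** Continuity up to [x0] included links the values of [b] inside the interval to [b x0 = 1]; [c]
    stays positive because [1 / a] is not controlled at [0]. *)
Lemma integral_factor_within c : 0 < c <= x0 -> {within `[c, x0], continuous b}.
Proof.
move=> /andP[c0 cx].
have h := parameterized_integral_continuous cx (inva_int c0).
have : {within `[c, x0], continuous (fun x =>
   expR (- (\int[mu]_(s in `[c, x0]) (a s)^-1 - \int[mu]_(s in `[c, x]) (a s)^-1)))}.
  move=> x; apply: (@continuous_comp (subspace `[c, x0]) R R (fun x =>
    - (\int[mu]_(s in `[c, x0]) (a s)^-1 - \int[mu]_(s in `[c, x]) (a s)^-1)) expR).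
    apply: continuousN; apply: continuousB; first exact: cst_continuous.
    exact: h.
  exact: continuous_expR.
apply: subspace_eq_continuous => x /set_mem /=; rewrite in_itv /= => /andP[hx hx'].
by rewrite /from_subspace /b (splitE c0 hx hx').
Qed.

Lemma integral_factor_is_derive x : 0 < x < x0 -> is_derive x 1 b (b x / a x).
Proof.
move=> /andP[xg xl].
(* Any base point strictly between [0] and [x] would do. *)
pose c := x / 2.
have c0 : 0 < c by rewrite divr_gt0.
have cx : c < x by rewrite /c; lra.
have hx : 0 < x <= x0 by rewrite xg ltW.
have [dF F'] := @continuous_FTC1_closed R (fun s => (a s)^-1) c x x0 xl
  (inva_int c0) cx (inva_cont hx).
have dI : is_derive x 1 (fun x => \int[mu]_(s in `[x, x0]) (a s)^-1) (- (a x)^-1).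
  apply: (@near_eq_is_derive _ _ _ (fun x =>
    \int[mu]_(s in `[c, x0]) (a s)^-1 - \int[mu]_(s in `[c, x]) (a s)^-1)).
    have : \forall z \near x, z \in `]c, x0[.
      by apply: near_in_itvoo; rewrite in_itv /= cx.
    apply: filterS => z; rewrite in_itv /= => /andP[h1 h2].
    by rewrite (splitE c0 (ltW h1) (ltW h2)).
  apply: (is_derive_eq (f' := 0 - (a x)^-1)); last by rewrite sub0r.
  have dF' : is_derive x 1 (fun x => \int[mu]_(s in `[c, x]) (a s)^-1) (a x)^-1.
    by rewrite -F' derive1E; apply: DeriveDef.
  exact: (is_derive_sub (is_derive_const _ _ _) dF').
apply: (is_derive_eq (f' := b x * (- - (a x)^-1))); last by rewrite opprK.
Qed.

End IntegralFactor.

(** * Lipschitz functions of the radius *)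

Section LipschitzOnUnitInterval.
Context {R : realType}.
Implicit Types k K : R -> R.

(** The constant may blow up as [r1] tends to [1], but the estimate reaches the axis value
    [r = 0]. *)
Definition lipschitz_below1 K := forall r1 : R, r1 < 1 -> exists L : R,
  forall r s, 0 <= r <= r1 -> 0 <= s <= r1 -> `|K r - K s| <= L * `|r - s|.

(* The value at [0] is the McShane infimum [inf_s (k s + L * s)]. *)
Lemma lipschitz_below1_extend k :
  (forall r1 : R, 0 < r1 < 1 -> exists L : R,
    forall r s, 0 < r <= r1 -> 0 < s <= r1 -> `|k r - k s| <= L * `|r - s|) ->
  exists2 K, (forall r, 0 < r -> K r = k r) & lipschitz_below1 K.
Proof.
move=> hk.
have [|L0 hL0] := hk 2^-1; first by lra.
pose L := `|L0|.
have hL r s : 0 < r <= 2^-1 -> 0 < s <= 2^-1 -> `|k r - k s| <= L * `|r - s|.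
  move=> hr hs; apply: le_trans (hL0 _ _ hr hs) _.
  by rewrite ler_wpM2r// ler_norm.
have L_ge0 : 0 <= L by rewrite normr_ge0.
pose E := [set k s + L * s | s in [set s : R | 0 < s <= 2^-1]].
have lbE r : 0 < r <= 2^-1 -> lbound E (k r - L * r).
  move=> hr _ [s /= hs <-].
  have := hL _ _ hr hs; rewrite ler_norml => /andP[_].
  have : L * `|r - s| <= L * (r + s).
    rewrite ler_wpM2l// ler_norml; lra.
  lra.
have E_half : has_inf E.
  split; last by exists (k 2^-1 - L * 2^-1); apply: lbE; lra.
  by exists (k 2^-1 + L * 2^-1), 2^-1 => //=; lra.
pose k0 := inf E.
have hk0 r : 0 < r <= 2^-1 -> `|k r - k0| <= L * r.
  move=> hr; rewrite ler_distlC; apply/andP; split.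
    by apply: lb_le_inf (lbE _ hr); case: E_half.
  apply: ge_inf; first by case: E_half.
  by exists r.
pose K r := if 0 < r then k r else k0.
exists K => [r r0|r1 r1_lt]; first by rewrite /K r0.
(* [r1] may be nonpositive, while the hypothesis on [k] asks for a positive bound. *)
pose r2 := Num.max r1 2^-1.
have [|L1 hL1] := hk r2.
  by rewrite /r2 lt_max gt_max r1_lt; apply/andP; split; [apply/orP; right|]; lra.
pose M := Num.max `|L1| L.
have M_ge0 : 0 <= M by rewrite le_max L_ge0 orbT.
have hM r s : 0 < r <= r1 -> 0 < s <= r1 -> `|k r - k s| <= M * `|r - s|.
  move=> /andP[r0 rr] /andP[s0 sr]; apply: le_trans (hL1 _ _ _ _) _.
  - by rewrite r0 le_max rr.
  - by rewrite s0 le_max sr.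
  by rewrite ler_wpM2r// le_max ler_norm.
have hM0 r : 0 < r <= r1 -> `|k r - k0| <= M * r.
  move=> /andP[r0 rr].
  (* The estimate against [k0] stops at radius [1/2], so larger radii go through [s]; as [s <= r],
     the two lengths add up to [r]. *)
  pose s := Num.min r 2^-1.
  have hs : 0 < s <= 2^-1 by rewrite lt_min r0 ge_min lexx orbT andbT/=; lra.
  have sr : s <= r by rewrite ge_min lexx.
  have h1 := hk0 _ hs.
  have h2 : `|k r - k s| <= M * (r - s).
    rewrite -[X in _ * X]ger0_norm ?subr_ge0//; apply: hM; rewrite ?r0//.
    by case/andP: hs => -> _; exact: le_trans rr.
  have h3 : L * s <= M * s.
    by rewrite ler_wpM2r ?le_max ?lexx ?orbT//; lra.
  have -> : k r - k0 = (k r - k s) + (k s - k0) by ring.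
  apply: le_trans (ler_normD _ _) _; lra.
exists M => r s /andP[r0 rr] /andP[s0 sr]; rewrite /K.
case: ifPn => hr; case: ifPn => hs.
- by apply: hM; rewrite ?hr ?hs.
- have -> : s = 0 by apply/eqP; rewrite eq_le s0 leNgt hs.
  by rewrite subr0 (ger0_norm r0); apply: hM0; rewrite hr.
- have -> : r = 0 by apply/eqP; rewrite eq_le r0 leNgt hr.
  by rewrite sub0r normrN distrC (ger0_norm s0); apply: hM0; rewrite hs.
- by rewrite subrr normr0 mulr_ge0.
Qed.

Lemma lipschitz_below1_bounded K : lipschitz_below1 K ->
  forall r1 : R, r1 < 1 -> exists B, forall r, 0 <= r <= r1 -> `|K r| <= B.
Proof.
move=> hK r1 r1_lt; have [L hL] := hK r1 r1_lt.
exists (`|K 0| + `|L|) => r /andP[r0 rr].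
have h : `|K r - K 0| <= L * `|r - 0|.
  by apply: hL; rewrite ?r0// lexx/= (le_trans r0).
have h' : L * `|r - 0| <= `|L|.
  rewrite subr0 (ger0_norm r0) (le_trans (ler_wpM2r r0 (ler_norm L)))//.
  by rewrite ler_piMr//; lra.
rewrite -[K r](subrK (K 0)) (le_trans (ler_normD _ _))//; lra.
Qed.

Lemma lipschitz_below1M K1 K2 : lipschitz_below1 K1 -> lipschitz_below1 K2 ->
  lipschitz_below1 (fun r => K1 r * K2 r).
Proof.
move=> h1 h2 r1 r1_lt.
have [L1 hL1] := h1 r1 r1_lt; have [L2 hL2] := h2 r1 r1_lt.
have [B1 hB1] := lipschitz_below1_bounded h1 r1_lt.
have [B2 hB2] := lipschitz_below1_bounded h2 r1_lt.
exists (B1 * L2 + B2 * L1) => r s hr hs.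
have -> : K1 r * K2 r - K1 s * K2 s =
  K1 r * (K2 r - K2 s) + K2 s * (K1 r - K1 s) by ring.
rewrite (le_trans (ler_normD _ _))// !normrM mulrDl -!mulrA.
by rewrite lerD// ler_pM// ?hB1 ?hB2 ?hL1 ?hL2.
Qed.

(** The tangent bound [1 + t <= expR t] at [t = v - u], multiplied by [expR u]. *)
Lemma expR_lipschitz (B u v : R) : u <= B -> v <= B ->
  `|expR u - expR v| <= expR B * `|u - v|.
Proof.
wlog vu : u v / v <= u.
  move=> H uB vB; have [|/ltW] := leP v u => h; first exact: H.
  by rewrite distrC [X in _ * X]distrC; exact: H.
move=> uB vB; rewrite !ger0_norm ?subr_ge0 ?ler_expR//.
have -> : expR v = expR u * expR (v - u) by rewrite -expRD; congr expR; ring.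
have h : 1 + (v - u) <= expR (v - u) by exact: expR_ge1Dx.
have h1 : expR u <= expR B by rewrite ler_expR.
have : expR u * (1 + (v - u)) <= expR u * expR (v - u).
  by rewrite ler_wpM2l// expR_ge0.
have : expR u * (u - v) <= expR B * (u - v) by rewrite ler_wpM2r// subr_ge0.
lra.
Qed.

Lemma lipschitz_below1_expR K : lipschitz_below1 K ->
  lipschitz_below1 (fun r => expR (K r)).
Proof.
move=> hK r1 r1_lt; have [L hL] := hK r1 r1_lt.
have [B hB] := lipschitz_below1_bounded hK r1_lt.
exists (expR B * L) => r s hr hs.
apply: le_trans (@expR_lipschitz B _ _ _ _) _.
- exact: le_trans (ler_norm _) (hB _ hr).
- exact: le_trans (ler_norm _) (hB _ hs).
by rewrite -mulrA ler_wpM2l ?expR_ge0// hL.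
Qed.

Lemma lipschitz_below1_id : lipschitz_below1 id.
Proof. by move=> r1 _; exists 1 => r s _ _; rewrite mul1r. Qed.

End LipschitzOnUnitInterval.

(** * The change of variable [r = b x] and its inverse *)

Section RadialCoordinate.
Context {R : realType}.
Variables (a b : R -> R) (x0 : R).
Hypothesis x0_gt0 : 0 < x0.
Hypothesis a_gt0 : forall x, 0 < x < x0 -> 0 < a x.
Hypothesis b_gt0 : forall x, 0 < b x.
Hypothesis b_end : b x0 = 1.
Hypothesis b_within : forall c, 0 < c <= x0 -> {within `[c, x0], continuous b}.
Hypothesis db : forall x, 0 < x < x0 -> is_derive x 1 b (b x / a x).
Variables (C d : R).
Hypothesis d_gt0 : 0 < d.
Hypothesis a_asymp : forall x, 0 < x < d -> `|a x - x| <= C * x ^+ 2.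

Lemma radial_increasing x y : 0 < x -> x < y -> y <= x0 -> b x < b y.
Proof.
move=> x_gt0 xy yx.
have hd z : z \in `]x, y[ -> is_derive z 1 b (b z / a z).
  by rewrite in_itv /= => /andP[h1 h2]; apply: db; lra.
have [|z zxy e] := MVT xy hd.
  apply: continuous_subspaceW (b_within (_ : 0 < x <= x0)); last by lra.
  by apply: subset_itv; rewrite bnd_simp.
rewrite -subr_gt0 e mulr_gt0 ?subr_gt0// divr_gt0 ?b_gt0// a_gt0//.
by move: zxy; rewrite in_itv /=; lra.
Qed.

Lemma radial_lt1 x : 0 < x < x0 -> 0 < b x < 1.
Proof. by move=> h; rewrite b_gt0 -b_end radial_increasing//; lra. Qed.

Lemma radial_inj x y : 0 < x < x0 -> 0 < y < x0 -> b x = b y -> x = y.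
Proof.
move=> hx hy e; have [h|h|//] := ltgtP x y.
  by have := @radial_increasing x y; rewrite e ltxx => H; suff: false by []; apply: H => //; lra.
by have := @radial_increasing y x; rewrite e ltxx => H; suff: false by []; apply: H => //; lra.
Qed.

(* [ln b x - ln x] has derivative [(x - a x) / (x * a x) = O(1)]. *)
Lemma radial_comparison : exists dl c1 c2, [/\ 0 < dl < x0, dl < d, 0 < c1, 0 < c2 &
  forall x, 0 < x <= dl -> [/\ x / 2 <= a x, c1 * x <= b x & b x <= c2 * x]].
Proof.
pose D := `|C| + 1.
have D0 : 0 < D by rewrite ltr_wpDl.
(* The three bounds give access to the asymptotics, to the derivative of [b], and to
   [D * x ^+ 2 <= x / 2], hence [x / 2 <= a x]. *)
pose dl := Num.min (d / 2) (Num.min (x0 / 2) (2 * D)^-1).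
have dl0 : 0 < dl by rewrite !lt_min !divr_gt0//= invr_gt0 mulr_gt0.
have dld : dl <= d / 2 by rewrite ge_min lexx.
have dlx : dl <= x0 / 2 by rewrite !ge_min lexx orbT.
have dlD : dl <= (2 * D)^-1 by rewrite !ge_min lexx !orbT.
have hA x : 0 < x <= dl -> `|a x - x| <= D * x ^+ 2.
  move=> hx; apply: le_trans (a_asymp _) _; first by lra.
  by rewrite ler_wpM2r ?sqr_ge0// /D; have := ler_norm C; lra.
have hA2 x : 0 < x <= dl -> x / 2 <= a x.
  move=> hx; have := hA _ hx; rewrite ler_distlC => /andP[_ h].
  have : D * x ^+ 2 <= x / 2.
    rewrite expr2 mulrA [X in _ <= X]mulrC ler_wpM2r//; first by lra.
    by rewrite -ler_pdivlMl// [leRHS]mulrC -invfM (le_trans _ dlD)//; lra.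
  lra.
have hI x : 0 < x <= dl -> `|(a x)^-1 - x^-1| <= 2 * D.
  move=> hx; have ax := hA2 _ hx; have x_gt0 : 0 < x by lra.
  have ax0 : 0 < a x by lra.
  have -> : (a x)^-1 - x^-1 = - (a x - x) / (x * a x) by field; rewrite !gt_eqF.
  rewrite normrM normrN normfV (gtr0_norm (mulr_gt0 x_gt0 ax0)).
  rewrite ler_pdivrMr ?mulr_gt0//; apply: le_trans (hA _ hx) _.
  have : D * (x * (x / 2)) <= D * (x * a x) by rewrite !ler_wpM2l// ltW.
  rewrite expr2; lra.
(* The slopes [s = 2 * D] and [s = - (2 * D)] make this function nondecreasing and nonincreasing
   respectively; comparing with its value at [dl] gives the two bounds. *)
have dI x s : 0 < x <= dl ->
    is_derive x 1 (fun y => (ln (b y) - ln y) + s * y) (((a x)^-1 - x^-1) + s).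
  move=> hx; have ax := hA2 _ hx; have x_gt0 : 0 < x by lra.
  have hb : is_derive x 1 b (b x / a x) by apply: db; lra.
  apply: is_derive_eq.
    exact: (is_derive_add (is_derive_sub
      (is_derive1_chain (is_derive1_ln (b_gt0 x)) hb) (is_derive1_ln x_gt0))
      (is_derive_scale s (is_derive_id x 1))).
  rewrite mulr1 mulrA mulVf ?mul1r// gt_eqF//.
(* Values of the monotone functions at [dl]; the leftover term [2 * D * x] has the favourable sign
   in both cases. *)
pose m := expR (ln (b dl) - ln dl - 2 * D * dl).
pose M := expR (ln (b dl) - ln dl + 2 * D * dl).
exists dl, m, M; split; rewrite ?expR_gt0//; [lra|lra|].
move=> x hx; split; first exact: hA2.
  rewrite -ler_ln ?posrE ?mulr_gt0 ?expR_gt0//; last by lra.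
  rewrite lnM ?posrE ?expR_gt0//; last by lra.
  rewrite expRK.
  have h : - ((ln (b x) - ln x) + (- (2 * D)) * x) <= - ((ln (b dl) - ln dl) + (- (2 * D)) * dl).
    apply: (@is_derive1_le _ (fun x => - ((ln (b x) - ln x) + (- (2 * D)) * x))
      (fun x => - (((a x)^-1 - x^-1) + - (2 * D)))).
    - by lra.
    - by move=> y hy; apply: is_deriveN (dI y _ _); lra.
    - move=> y hy; have := hI y; rewrite ler_norml; lra.
  have : 0 <= 2 * D * x by rewrite !mulr_ge0//; lra.
  lra.
rewrite -ler_ln ?posrE ?mulr_gt0 ?expR_gt0//; last by lra.
rewrite lnM ?posrE ?expR_gt0//; last by lra.
rewrite expRK.
have h : ((ln (b x) - ln x) + (2 * D) * x) <= ((ln (b dl) - ln dl) + (2 * D) * dl).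
  apply: (@is_derive1_le _ (fun x => (ln (b x) - ln x) + (2 * D) * x)
    (fun x => ((a x)^-1 - x^-1) + 2 * D)).
  - by lra.
  - by move=> y hy; apply: dI; lra.
  - move=> y hy; have := hI y; rewrite ler_norml; lra.
have : 0 <= 2 * D * x by rewrite !mulr_ge0//; lra.
lra.
Qed.

(** Intermediate values: [b x <= c2 * x] forces [b] to [0] at the axis, and [b] reaches [1] at
    [x0]. *)
Lemma radial_surj r : 0 < r < 1 -> exists2 x, 0 < x < x0 & b x = r.
Proof.
move=> /andP[r0 r1].
have [dl [c1 [c2 [hdl _ _ c20 hb]]]] := radial_comparison.
(* Chosen so that [c2 * x1 <= r / 2]. *)
pose x1 := Num.min dl (r / (2 * c2)).
have x10 : 0 < x1 by rewrite lt_min divr_gt0 ?mulr_gt0// andbT; lra.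
have x1l : x1 <= dl by rewrite ge_min lexx.
have bx1 : b x1 <= r / 2.
  have [|_ _ h] := hb x1; first by lra.
  apply: le_trans h _; rewrite -ler_pdivlMl//.
  have -> : c2^-1 * (r / 2) = r / (2 * c2) by field; rewrite gt_eqF.
  by rewrite ge_min lexx orbT.
have x1x0 : x1 <= x0 by lra.
have bw : {within `[x1, x0], continuous b} by apply: b_within; rewrite x10.
have [|x] := IVT (v := r) x1x0 bw.
  by rewrite b_end ge_min le_max; apply/andP; split; apply/orP; [left|right]; lra.
rewrite in_itv /= => hx e; exists x => //.
apply/andP; split; first by lra.
rewrite lt_neqAle; apply/andP; split; last by lra.
by apply/eqP => xe; move: e; rewrite xe b_end; lra.
Qed.

(** The default [0] is the value at radii outside []0, 1[], in particular on the axis. *)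
Definition radial_inv (r : R) : R := xget 0 [set x | 0 < x < x0 /\ b x = r].

Lemma radial_invP r : 0 < r < 1 -> 0 < radial_inv r < x0 /\ b (radial_inv r) = r.
Proof.
move=> hr; apply: (@xgetPex _ 0 [set x | 0 < x < x0 /\ b x = r]).
by have [x hx e] := radial_surj hr; exists x.
Qed.

Lemma radialK x : 0 < x < x0 -> radial_inv (b x) = x.
Proof.
by move=> hx; have [h e] := radial_invP (radial_lt1 hx); apply: radial_inj.
Qed.

(** Since [b' = b / a], the hypothesis says [|l'| <= L * b']; both [L * b + l] and [L * b - l] are
    then nondecreasing, which bounds increments of [l] by those of [b] without differentiating the
    inverse. *)
Lemma radial_dominated_lipschitz (l dl : R -> R) :
  (forall x, 0 < x < x0 -> is_derive x 1 l (dl x)) ->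
  (forall x1, 0 < x1 < x0 -> exists L, forall x, 0 < x <= x1 ->
      `|dl x| <= L * (b x / a x)) ->
  forall r1, 0 < r1 < 1 -> exists L, forall r s, 0 < r <= r1 -> 0 < s <= r1 ->
    `|l (radial_inv r) - l (radial_inv s)| <= L * `|r - s|.
Proof.
move=> hl hdl r1 hr1; have [hx1 bx1] := radial_invP hr1.
have [L hL] := hdl _ hx1; exists L => r s hr hs.
wlog : r s hr hs / radial_inv r <= radial_inv s.
  move=> H; have [|/ltW h] := leP (radial_inv r) (radial_inv s); first exact: H.
  by rewrite distrC [X in _ * X]distrC; exact: H.
have hr' : 0 < r < 1 by lra.
have hs' : 0 < s < 1 by lra.
have [hx bx] := radial_invP hr'; have [hy by_] := radial_invP hs'.
set x := radial_inv r in hx bx *; set y := radial_inv s in hy by_ *.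
have yx1 : y <= radial_inv r1.
  rewrite leNgt; apply/negP => h.
  have : b (radial_inv r1) < b y by apply: radial_increasing; lra.
  by rewrite bx1 by_; lra.
move=> xy.
have rs : r <= s.
  move: xy; rewrite le_eqVlt => /predU1P[e|h]; first by rewrite -bx e by_.
  by rewrite -bx -by_ ltW// radial_increasing//; lra.
rewrite distrC [X in _ * X]distrC [X in _ * X]ger0_norm ?subr_ge0// -bx -by_ ler_norml.
(* Used with [e = 1] and [e = -1], one for each side of the absolute value. *)
have key (e : R) : `|e| = 1 -> L * b x + e * l x <= L * b y + e * l y.
  move=> e1; apply: (@is_derive1_le _ (fun x => L * b x + e * l x)
      (fun x => L * (b x / a x) + e * dl x)) => // z hz.
    have [hz1 hz2] : is_derive z 1 b (b z / a z) /\ is_derive z 1 l (dl z).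
      by split; [apply: db|apply: hl]; lra.
    exact: is_derive_add (is_derive_scale L hz1) (is_derive_scale e hz2).
  have h : `|e * dl z| <= L * (b z / a z) by rewrite normrM e1 mul1r; apply: hL; lra.
  by move: h; rewrite ler_norml; lra.
have := key 1 (normr1 _); have := key (-1) (normrN1 _); lra.
Qed.

End RadialCoordinate.

(** * Elementary bounds on sine and cosine near [0] *)

Section TrigonometricBounds.
Context {R : realType}.
Implicit Types x : R.

Lemma cosR_ge1B x : 0 <= x -> 1 - x <= cos x.
Proof.
move=> x0.
have : cos 0 + 0 <= cos x + x.
  apply: (@is_derive1_le _ (fun x => cos x + x) (fun x => - sin x + 1)) => //.
by rewrite cos0; lra.
Qed.

(** The middle term has derivative [x * sin x], which lies between [0] and [2 * x]. *)
Lemma sinB_mul_cos x : 0 <= x <= 1 -> 0 <= sin x - x * cos x <= x ^+ 2.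
Proof.
move=> /andP[x0 x1].
have dg (z : R) : is_derive z 1 (fun z => sin z - z * cos z) (z * sin z).
  have h := is_derive_sub (is_derive_sin z)
    (is_derive_mul (is_derive_id z 1) (is_derive_cos z)).
  by apply: (is_derive_eq h); rewrite /=; ring.
have sin_ge0' z : 0 <= z <= x -> 0 <= sin z.
  by move=> hz; apply: sin_ge0_pi; have := @pi_ge2 R; lra.
have h1 : sin 0 - 0 * cos 0 <= sin x - x * cos x.
  apply: (@is_derive1_le _ (fun z => sin z - z * cos z) (fun z => z * sin z)) => //.
  by move=> z hz; rewrite mulr_ge0 ?sin_ge0'//; lra.
have h2 : 0 * 0 - (sin 0 - 0 * cos 0) <= x * x - (sin x - x * cos x).
  apply: (@is_derive1_le _ (fun z => z * z - (sin z - z * cos z))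
    (fun z => (z * 1 + z * 1) - z * sin z)) => //.
  move=> z hz; have : z * sin z <= z * 1 by rewrite ler_wpM2l ?sin_le1//; lra.
  lra.
by move: h1 h2; rewrite sin0 expr2; lra.
Qed.

(** Chain of bounds: [sin x >= x * cos x >= x * (1 - x) >= x / 2]. *)
Lemma sin_ge_half x : 0 <= x <= 2^-1 -> x / 2 <= sin x.
Proof.
move=> hx; have /andP[h _] := @sinB_mul_cos x ltac:(lra).
have : x * (1 - x) <= x * cos x by rewrite ler_wpM2l ?cosR_ge1B//; lra.
have : x * 2^-1 <= x * (1 - x) by rewrite ler_wpM2l//; lra.
lra.
Qed.

End TrigonometricBounds.

(** * The logarithmic derivative of the conformal profile *)

Section ConformalFactor.
Context {R : realType}.
Variables (a a1 b : R -> R) (x0 : R).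
Hypothesis x0_itv : 0 < x0 < pi / 2.
Hypothesis a_gt0 : forall x, 0 < x < x0 -> 0 < a x.
Hypothesis da : forall x, 0 < x < x0 -> is_derive x 1 a (a1 x).
Hypothesis a1_cont : forall x, 0 < x < x0 -> {for x, continuous a1}.
Hypothesis b_gt0 : forall x, 0 < b x.
Hypothesis db : forall x, 0 < x < x0 -> is_derive x 1 b (b x / a x).
Variables (C d : R).
Hypothesis d_gt0 : 0 < d.
Hypothesis a_asymp : forall x, 0 < x < d ->
  `|a x - x| <= C * x ^+ 2 /\ `|a1 x - 1| <= C * x.

Lemma sin_gt0_x0 x : 0 < x < x0 -> 0 < sin x.
Proof.
by move=> hx; apply: sin_gt0_pihalf; have := x0_itv; move: hx; lra.
Qed.

Definition log_factor (x : R) : R := 2 * ln (sin x) - ln (a x) - ln (b x).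

Lemma expR_log_factor x : 0 < x < x0 ->
  expR (log_factor x) = sin x ^+ 2 / (a x * b x).
Proof.
move=> hx; have sx := sin_gt0_x0 hx; have ax := a_gt0 hx.
rewrite /log_factor mulr_natl mulr2n !expRD !expRN !lnK ?posrE//.
by rewrite invfM expr2 mulrA.
Qed.

Let psi (x : R) : R := 2 * (a x * (cos x / sin x)) - a1 x - 1.

Lemma log_factor_is_derive x : 0 < x < x0 ->
  is_derive x 1 log_factor (psi x / a x).
Proof.
move=> hx; have sx := sin_gt0_x0 hx; have ax := a_gt0 hx.
have h := is_derive_sub (is_derive_sub (is_derive_scale 2
   (is_derive1_chain (is_derive1_ln sx) (is_derive_sin x)))
   (is_derive1_chain (is_derive1_ln ax) (da hx)))
   (is_derive1_chain (is_derive1_ln (b_gt0 x)) (db hx)).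
by apply: (is_derive_eq h); rewrite /psi; field; rewrite !gt_eqF.
Qed.

(** Splits [psi] into [2 (a - x) cot x], [- 2 (sin x - x cos x) / sin x] and [- (a1 - 1)], of sizes
    [4 |C| x], [4 x] and [|C| x]. *)
Let psi_near0 x : 0 < x -> x <= 2^-1 -> x < d -> `|psi x| <= (5 * `|C| + 4) * x.
Proof.
move=> x_gt0 xh xd.
have sx := @sin_ge_half _ x ltac:(lra).
have s_gt0 : 0 < sin x by lra.
(* Division by [sin x >= x / 2] costs one power of [x] and a factor [2]. *)
have hcot y K : `|y| <= K * x ^+ 2 -> `|y / sin x| <= 2 * K * x.
  move=> h; rewrite normrM normfV (gtr0_norm s_gt0) ler_pdivrMr//.
  have K0 : 0 <= K by rewrite -(pmulr_lge0 _ (_ : 0 < x ^+ 2)) ?exprn_gt0// (le_trans _ h).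
  apply: le_trans h _.
  have : K * x * (x / 2) <= K * x * sin x by rewrite ler_wpM2l// mulr_ge0// ltW.
  rewrite expr2; lra.
have [h1 h2] := @a_asymp x ltac:(lra).
have Cle : C <= `|C| by exact: ler_norm.
have e1 : `|(a x - x) * cos x / sin x| <= 2 * `|C| * x.
  apply: hcot; rewrite normrM; apply: (@le_trans _ _ (`|a x - x| * 1)).
    by rewrite ler_wpM2l// ler_norml cos_geN1 cos_le1.
  by rewrite mulr1 (le_trans h1)// ler_wpM2r// sqr_ge0.
have e2 : `|(sin x - x * cos x) / sin x| <= 2 * 1 * x.
  apply: hcot; have := @sinB_mul_cos _ x ltac:(lra).
  by rewrite mul1r => /andP[h3 h4]; rewrite ger0_norm.
have e3 : `|a1 x - 1| <= `|C| * x.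
  by apply: le_trans h2 _; rewrite ler_wpM2r// ltW.
have -> : psi x = 2 * ((a x - x) * cos x / sin x)
   - 2 * ((sin x - x * cos x) / sin x) - (a1 x - 1).
  by rewrite /psi; field; rewrite gt_eqF.
by move: e1 e2 e3; rewrite !ler_norml; lra.
Qed.

(** Near [0] the linear bound on [psi] is absorbed by [c1 * x <= b x]; on the remaining compact
    interval the continuous function [|psi| / b] attains a maximum. *)
Lemma log_factor_dominated x1 : 0 < x1 < x0 ->
  exists L, forall x, 0 < x <= x1 -> `|psi x / a x| <= L * (b x / a x).
Proof.
move=> hx1.
have [|dl [c1 [c2 [hdl dld c10 _ hb]]]] :=
  @radial_comparison _ a b x0 _ b_gt0 db C d d_gt0 (fun x h => (a_asymp h).1).
  by lra.
pose e := Num.min dl 2^-1.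
have e_gt0 : 0 < e by rewrite lt_min; apply/andP; split; lra.
have e_dl : e <= dl by rewrite ge_min lexx.
have e_h : e <= 2^-1 by rewrite ge_min lexx orbT.
(* Keeps the interval from [e] to [y1] nonempty even when [x1 < e]. *)
pose y1 := Num.max e x1.
have ey1 : e <= y1 by rewrite le_max lexx.
have xy1 : x1 <= y1 by rewrite le_max lexx orbT.
have y1x0 : y1 < x0 by rewrite gt_max; apply/andP; split; lra.
have [z _ hz] : exists2 c, c \in `[e, y1] &
    forall t, t \in `[e, y1] -> `|psi t| / b t <= `|psi c| / b c.
  apply: EVT_max => //; apply: continuous_in_subspaceT => x /set_mem /=.
  rewrite in_itv /= => hx; have hx0 : 0 < x < x0 by lra.
  have cb := is_derive1_continuous (db hx0).
  have ca := is_derive1_continuous (da hx0).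
  have sx : sin x != 0 by rewrite gt_eqF// sin_gt0_x0.
  have cpsi : {for x, continuous psi}.
    apply: continuousB; last exact: cst_continuous.
    apply: continuousB; last exact: a1_cont.
    apply: continuousM; first exact: cst_continuous.
    apply: continuousM => //; apply: continuousM; first exact: continuous_cos.
    by apply: continuousV => //; exact: continuous_sin.
  apply: (@continuousM _ _ (fun t => `|psi t|) (fun t => (b t)^-1)).
    apply: (@continuous_comp _ _ _ psi (fun y => `|y|)) => //.
    exact: norm_continuous.
  by apply: continuousV => //; rewrite gt_eqF.
pose M := `|psi z| / b z.
pose D := (5 * `|C| + 4) / c1.
exists (Num.max M D) => x hx.
have ax : 0 < a x by apply: a_gt0; lra.
have bx := b_gt0 x.
rewrite normrM normfV (gtr0_norm ax) mulrA.
rewrite ler_wpM2r ?invr_ge0 ?(ltW ax)//.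
have [xe|ex] := leP x e.
  have h := @psi_near0 x ltac:(lra) ltac:(lra) ltac:(lra).
  have [|_ h1 _] := hb x; first by lra.
  apply: le_trans h _.
  have h2 : D * (c1 * x) <= D * b x.
    by rewrite ler_wpM2l// /D divr_ge0 ?(ltW c10)//; have := normr_ge0 C; lra.
  have h3 : D * b x <= Num.max M D * b x by rewrite ler_wpM2r ?le_max ?lexx ?orbT// ltW.
  apply: le_trans h3; apply: le_trans h2.
  by rewrite /D mulrA divfK// gt_eqF.
have := hz x; rewrite in_itv /= ler_pdivrMr// => /(_ _)/le_trans -> //; first by lra.
by rewrite ler_wpM2r ?le_max ?lexx// ltW.
Qed.

End ConformalFactor.

(** * The Euclidean norm and its comparison with the sup norm *)

Section Euclidean.
Context {R : realType} {n : nat}.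
Implicit Types u v w : 'rV[R]_n.

Lemma edotE u v : edot u v = \sum_i u 0 i * v 0 i.
Proof. by rewrite /edot mxE; apply: eq_bigr => i _; rewrite mxE. Qed.

Lemma esqE u : esq u = \sum_i u 0 i ^+ 2.
Proof. by rewrite /esq edotE; apply: eq_bigr => i _; rewrite expr2. Qed.

Lemma edotC u v : edot u v = edot v u.
Proof. by rewrite !edotE; apply: eq_bigr => i _; rewrite mulrC. Qed.

Lemma edotDl u v w : edot (u + v) w = edot u w + edot v w.
Proof. by rewrite /edot mulmxDl mxE. Qed.

Lemma edotZl c u v : edot (c *: u) v = c * edot u v.
Proof. by rewrite /edot -scalemxAl mxE. Qed.

Lemma edotZr c u v : edot u (c *: v) = c * edot u v.
Proof. by rewrite edotC edotZl edotC. Qed.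

Lemma edotNr u v : edot u (- v) = - edot u v.
Proof. by rewrite -scaleN1r edotZr mulN1r. Qed.

Lemma esq0 : esq (0 : 'rV[R]_n) = 0.
Proof. by rewrite /esq /edot mul0mx mxE. Qed.

Lemma esqZ c u : esq (c *: u) = c ^+ 2 * esq u.
Proof. by rewrite /esq edotZl edotZr mulrA expr2. Qed.

Lemma esqD u v : esq (u + v) = esq u + 2 * edot u v + esq v.
Proof.
rewrite /esq edotDl (edotC u (u + v)) (edotC v (u + v)) !edotDl (edotC v u).
by ring.
Qed.

Lemma esqN u : esq (- u) = esq u.
Proof. by rewrite -scaleN1r esqZ; ring. Qed.

Lemma esq_ge0 u : 0 <= esq u.
Proof. by rewrite esqE sumr_ge0// => i _; exact: sqr_ge0. Qed.

Lemma esq_eq0 u : (esq u == 0) = (u == 0).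
Proof.
apply/eqP/eqP => [h|->]; last exact: esq0.
apply/rowP => i; rewrite mxE; apply/eqP; rewrite -sqrf_eq0.
move/eqP: h; rewrite esqE psumr_eq0; last by move=> j _; exact: sqr_ge0.
by move/allP/(_ i); rewrite mem_index_enum => /(_ isT).
Qed.

(** Cauchy-Schwarz: expand the square of [esq v *: u - edot u v *: v], which equals [esq v] times
    the difference of the two sides. *)
Lemma edot_le u v : edot u v ^+ 2 <= esq u * esq v.
Proof.
have [/eqP|v0] := eqVneq v 0.
  rewrite -esq_eq0 => /eqP h; have v0 : v = 0 by apply/eqP; rewrite -esq_eq0 h.
  by rewrite v0 esq0 edotC /edot mul0mx mxE expr0n mulr0.
have v_gt0 : 0 < esq v by rewrite lt_neqAle esq_ge0 eq_sym esq_eq0 v0.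
have := esq_ge0 (esq v *: u + - edot u v *: v).
rewrite esqD !esqZ edotZl edotZr.
have -> : esq v ^+ 2 * esq u + 2 * (esq v * (- edot u v * edot u v)) +
  (- edot u v) ^+ 2 * esq v = esq v * (esq u * esq v - edot u v ^+ 2) by ring.
by rewrite pmulr_rge0// subr_ge0.
Qed.

(** Kept apart from [|u|], which on row vectors is the sup norm and governs neighbourhoods and
    Lipschitz constants. *)
Definition enorm u : R := Num.sqrt (esq u).

Lemma enorm_ge0 u : 0 <= enorm u. Proof. exact: sqrtr_ge0. Qed.

Lemma sqr_enorm u : enorm u ^+ 2 = esq u.
Proof. by rewrite sqr_sqrtr// esq_ge0. Qed.

Lemma enormB u v : `|enorm u - enorm v| <= enorm (u - v).
Proof.
rewrite -(ger0_norm (enorm_ge0 (u - v))) -ler_sqr ?nnegrE// -!normrX.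
rewrite !ger0_norm ?sqr_ge0// sqr_enorm esqD esqN edotNr.
rewrite sqrrB !sqr_enorm mulr2n.
have : edot u v <= enorm u * enorm v.
  apply: le_trans (ler_norm _) _.
  rewrite -[leRHS]ger0_norm ?mulr_ge0 ?enorm_ge0//.
  rewrite -ler_sqr ?nnegrE// -!normrX exprMn !sqr_enorm.
  by rewrite !ger0_norm ?sqr_ge0 ?mulr_ge0 ?esq_ge0 ?edot_le.
lra.
Qed.

End Euclidean.

Section SupNorm.
Context {R : realType}.

Lemma mx_coord_le m n (A : 'M[R]_(m, n)) i j : `|A i j| <= `|A|.
Proof.
by rewrite [leRHS]/Num.norm /= mx_normrE; apply/bigmax_geP; right; exists (i, j).
Qed.

Lemma mx_norm_le m n (A : 'M[R]_(m, n)) (c : R) : 0 <= c ->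
  (forall i j, `|A i j| <= c) -> `|A| <= c.
Proof.
move=> c0 h; rewrite [leLHS]/Num.norm /= mx_normrE.
by apply/bigmax_leP; split => // i _; exact: h.
Qed.

Lemma enorm_le n (u : 'rV[R]_n) : enorm u <= n%:R * `|u|.
Proof.
have h0 : 0 <= n%:R * `|u| by rewrite mulr_ge0.
rewrite -(ger0_norm h0) -(ger0_norm (enorm_ge0 u)) -ler_sqr ?nnegrE// -!normrX.
rewrite !ger0_norm ?sqr_ge0// sqr_enorm esqE exprMn.
apply: (@le_trans _ _ (\sum_(i < n) `|u| ^+ 2)).
  apply: ler_sum => i _; rewrite -real_normK ?num_real//.
  by rewrite ler_sqr ?nnegrE// mx_coord_le.
(* The sum gives [n], and [n <= n ^ 2] trades the sharp constant, the root of [n], for [n]. *)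
rewrite sumr_const card_ord -[X in X <= _]mulr_natl ler_wpM2r ?sqr_ge0//.
by rewrite -natrX ler_nat; case: n {u h0} => // n; rewrite expnS leq_pmulr// expn_gt0.
Qed.

Lemma ycoord_le n (p : 'rV[R]_(1 + n)) : `|ycoord p| <= `|p|.
Proof. by apply: mx_norm_le => // i j; rewrite mxE mx_coord_le. Qed.

End SupNorm.

(** * Functions of the radius on the cylinder *)

Section RadialExtension.
Context {R : realType} {n : nat}.
Local Notation V := 'rV[R]_(1 + n).
Implicit Types p q : V.

Definition radius p : R := enorm (ycoord p).

Lemma radius_ge0 p : 0 <= radius p. Proof. exact: enorm_ge0. Qed.

Lemma radiusB p q : `|radius p - radius q| <= n%:R * `|p - q|.
Proof.
apply: le_trans (enormB _ _) _; apply: le_trans (enorm_le _) _.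
by rewrite ler_wpM2l// -[_ - _]/(ycoord p - ycoord q) -linearB ycoord_le.
Qed.

Lemma radius_lt1 p : (radius p < 1) = (esq (ycoord p) < 1).
Proof. by rewrite -sqr_enorm -[RHS]/(radius p ^+ 2 < 1) expr_lt1// radius_ge0. Qed.

Lemma radius_gt0 p : (0 < radius p) = (0 < esq (ycoord p)).
Proof. by rewrite sqrtr_gt0. Qed.

Lemma nbhs_radius_lt p (r : R) : radius p < r -> nbhs p [set q | radius q < r].
Proof.
(* The radius function is [n]-Lipschitz; the extra [1] keeps the denominator positive for
   [n = 0]. *)
move=> h; apply/nbhs_ballP; exists ((r - radius p) / (n%:R + 1)) => /=.
  by rewrite divr_gt0 ?subr_gt0// ltr_wpDl.
move=> q; rewrite -ball_normE /= distrC => hq.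
have := radiusB q p; rewrite ler_norml => /andP[_ h1].
have : (n%:R + 1) * `|q - p| < r - radius p.
  by rewrite mulrC -ltr_pdivlMr// ltr_wpDl.
have := normr_ge0 (q - p); lra.
Qed.

Lemma nbhs_radius_gt p (r : R) : r < radius p -> nbhs p [set q | r < radius q].
Proof.
move=> h; apply/nbhs_ballP; exists ((radius p - r) / (n%:R + 1)) => /=.
  by rewrite divr_gt0 ?subr_gt0// ltr_wpDl.
move=> q; rewrite -ball_normE /= distrC => hq.
have := radiusB q p; rewrite ler_norml => /andP[h1 _].
have : (n%:R + 1) * `|q - p| < radius p - r.
  by rewrite mulrC -ltr_pdivlMr// ltr_wpDl.
have := normr_ge0 (q - p); lra.
Qed.

Lemma open_Mset : open (@Mset R n).
Proof.
rewrite openE => p /andP[h1 h2].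
have := nbhs_radius_gt (_ : 0 < radius p); rewrite radius_gt0 => /(_ h1) k1.
have := nbhs_radius_lt (_ : radius p < 1); rewrite radius_lt1 => /(_ h2) k2.
apply: filterS2 k1 k2 => q /=.
by rewrite radius_gt0 radius_lt1 /Mset /= => -> ->.
Qed.

Lemma radial_lipschitz K : lipschitz_below1 K -> forall r1 : R, r1 < 1 ->
  exists L, forall p q, radius p <= r1 -> radius q <= r1 ->
    `|K (radius p) - K (radius q)| <= L * `|p - q|.
Proof.
move=> hK r1 hr; have [L hL] := hK r1 hr.
exists (`|L| * n%:R) => p q hp hq.
apply: le_trans (hL _ _ _ _) _; rewrite ?radius_ge0//.
apply: le_trans (ler_wpM2r (normr_ge0 _) (ler_norm L)) _.
by rewrite -mulrA ler_wpM2l ?radiusB.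
Qed.

Lemma radial_loc_lipschitz (W : normedModType R) (F : V -> W) :
  (forall r1 : R, r1 < 1 -> exists L, forall p q, radius p <= r1 ->
    radius q <= r1 -> `|F p - F q| <= L * `|p - q|) ->
  loc_lipschitz_on (@Mbar R n) F.
Proof.
move=> hF p; rewrite /Mbar /= -radius_lt1 => hp.
(* The midpoint between the radius of [p] and [1] leaves room for a neighbourhood on which one
   constant serves. *)
have [L hL] := hF ((radius p + 1) / 2) ltac:(lra).
exists [set q | radius q < (radius p + 1) / 2]; first by apply: nbhs_radius_lt; lra.
by exists L => q r /= hq _ hr _; apply: hL; exact: ltW.
Qed.

End RadialExtension.

Lemma loc_lipschitz_within_continuous {R : realType} (V W : normedModType R)
  (A : set V) (f : V -> W) : loc_lipschitz_on A f -> {within A, continuous f}.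
Proof.
move=> hf; apply/subspace_continuousP => p Ap.
have [U nU [L hL]] := hf p Ap.
apply/cvgrPdist_le => e e0.
have pU := nbhs_singleton nU.
near=> q.
have Aq : A q by near: q; exact: withinT.
have Uq : U q by near: q; apply: cvg_within.
apply: le_trans (hL _ _ pU Ap Uq Aq) _.
apply: le_trans (ler_wpM2r (normr_ge0 _) (ler_norm L)) _.
have h : `|p - q| <= e / (`|L| + 1).
  by near: q; apply: cvg_within; apply: cvgr_dist_le => //; rewrite divr_gt0// ltr_wpDl.
apply: (@le_trans _ _ ((`|L| + 1) * `|p - q|)).
  by rewrite ler_wpM2r// lerDl.
by rewrite mulrC -ler_pdivlMr// ltr_wpDl.
Unshelve. all: by end_near. Qed.

Lemma lipschitz_derive_le {R : realType} (V W : normedModType R) (f : V -> W)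
  (L : R) (q v : V) (U : set V) : nbhs q U ->
  (forall r, U r -> `|f r - f q| <= L * `|r - q|) ->
  derivable f q v -> `|'D_v f q| <= L * `|v|.
Proof.
move=> nU hL dfv; rewrite /derive -lim_norm//.
apply: limr_le; first exact: is_cvg_norm.
have h0 : (fun h : R => h *: v + q) @ 0^' --> q.
  rewrite -[X in _ --> X]add0r -[X in X + _](scale0r v).
  apply: cvgD; last exact: cvg_cst.
  by apply: cvgZr_tmp; apply: cvg_within.
near=> h.
have hn : h != 0 by near: h; exact: nbhs_dnbhs_neq.
rewrite normrZ normfV ler_pdivrMl ?normr_gt0//.
have : U (h *: v + q) by near: h; apply: h0.
by move=> /hL; rewrite addrK normrZ /= => /le_trans -> //; rewrite mulrCA.
Unshelve. all: by end_near. Qed.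

(** * Smoothness from classes stable under differentiation *)

Section SmoothClasses.
Context {R : realType} {V W : normedModType R}.
Implicit Types (f g : V -> W) (U : set V).

(** The first-order expansion of [f] at [p] is also one for [g], and [diff_unique] then identifies
    the differentials. *)
Lemma near_eq_differentiable f g p : {near p, f =1 g} ->
  differentiable f p -> differentiable g p.
Proof.
move=> fg df; have [cdf e] := (diff_locallyP p f).1 df.
have fgp : f p = g p by exact: nbhs_singleton fg.
have key : g \o shift p = cst (g p) + 'd f p +o_ 0 id.
  apply/eqaddoP => eps eps0.
  have /eqaddoP /(_ _ eps0) := e.
  have : \forall h \near 0, f (h + p) = g (h + p).
    have h0 : (fun h : V => h + p) @ 0 --> p.
      by rewrite -[X in _ --> X]add0r; apply: cvgD => //; exact: cvg_cst.
    exact: h0 fg.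
  apply: filterS2 => h h1 h2.
  by rewrite /= -[X in `|X|]/(g (h + p) - (g p + 'd f p h)) -h1 -fgp.
have dge := diff_unique cdf key.
by apply/diff_locallyP; split; rewrite dge.
Qed.

Lemma smooth_on_eq U f g : open U -> (forall p, U p -> f p = g p) ->
  smooth_on U f -> smooth_on U g.
Proof.
move=> oU fg sf.
have H vs : forall p, U p -> Defs.iterD vs f p = Defs.iterD vs g p.
  elim: vs => [|v vs ih] p Up; first exact: fg.
  by apply: near_eq_derive; near=> q; apply: ih; near: q; exact: open_nbhs_nbhs.
move=> vs p Up; apply: near_eq_differentiable (sf vs p Up).
by near=> q; apply: H; near: q; exact: open_nbhs_nbhs.
Unshelve. all: by end_near. Qed.

(** Iterated derivatives are never computed: each agrees on [U] with some member of [A], and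
    openness of [U] lets that agreement pass to the next derivative. *)
Lemma smooth_on_closed_class U (A : set (V -> W)) : open U ->
  (forall f, A f -> forall p, U p -> differentiable f p) ->
  (forall f v, A f -> exists2 g, A g & forall p, U p -> 'D_v f p = g p) ->
  forall f, A f -> smooth_on U f.
Proof.
move=> oU dA DA f Af.
have H vs : exists2 g, A g & forall p, U p -> Defs.iterD vs f p = g p.
  elim: vs => [|v vs [g Ag hg]]; first by exists f.
  have [g' Ag' hg'] := DA _ v Ag; exists g' => // p Up.
  rewrite -hg' //=; apply: near_eq_derive.
  by near=> q; apply: hg; near: q; exact: open_nbhs_nbhs.
move=> vs p Up; have [g Ag hg] := H vs.
apply: (@near_eq_differentiable g); last exact: dA.
by near=> q; rewrite hg//; near: q; exact: open_nbhs_nbhs.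
Unshelve. all: by end_near. Qed.

End SmoothClasses.

(** * Affine curves, for the smoothness of [J] *)

Section AffineCurve.
Context {R : realType} {V : normedModType R}.

Lemma derive_affine (u w : V) (v t : R) : 'D_v (fun s : R => s *: u + w) t = v *: u.
Proof.
apply: lim_near_cst; first exact: norm_hausdorff.
near=> h; have h0 : h != 0 by near: h; exact: nbhs_dnbhs_neq.
rewrite /= opprD addrACA subrr addr0 -scalerBl addrK scalerA.
by rewrite -[h *: v]/(h * v) mulKf.
Unshelve. all: by end_near. Qed.

Lemma smooth_affine (u w : V) : smooth_on setT (fun s : R => s *: u + w).
Proof.
apply: (@smooth_on_closed_class _ _ _ _
  [set f | exists u w : V, f = fun s : R => s *: u + w]).
- exact: openT.
- move=> _ [u' [w' ->]] p _.
  apply: differentiableD; last exact: differentiable_cst.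
  exact: differentiableZl.
- move=> _ v [u' [w' ->]]; exists (fun s : R => s *: 0 + v *: u').
    by exists 0, (v *: u').
  by move=> p _; rewrite derive_affine scaler0 add0r.
by exists u, w.
Qed.

End AffineCurve.

(** * Derivatives of the inner product and the squared norm *)

Section EuclideanDerivatives.
Context {R : realType} {n : nat}.
Local Notation V := 'rV[R]_(1 + n).
Implicit Types (p v : V) (w : 'rV[R]_n).

Lemma coord_is_derive (j : 'I_(1 + n)) p v :
  is_derive p v (fun q : V => q 0 j : R) (v 0 j).
Proof.
apply: DeriveDef; first by apply: diff_derivable; exact: differentiable_coord.
apply: lim_near_cst; first exact: norm_hausdorff.
near=> h; have h0 : h != 0 by near: h; exact: nbhs_dnbhs_neq.
by rewrite /= !mxE addrK -[_ *: (_ * _)]/(_ * (_ * _)) mulKf.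
Unshelve. all: by end_near. Qed.

Lemma differentiable_bigsum m (F : 'I_m -> V -> R) p :
  (forall i, differentiable (F i) p) ->
  differentiable (fun q => \sum_(i < m) F i q) p.
Proof.
move=> h; have -> : (fun q => \sum_(i < m) F i q) = \sum_(i < m) F i.
  by apply/funext => q; rewrite fct_sumE.
exact: differentiable_sum.
Qed.

Lemma is_derive_bigsum m (F : 'I_m -> V -> R) (dF : 'I_m -> R) p v :
  (forall i, is_derive p v (F i) (dF i)) ->
  is_derive p v (fun q => \sum_(i < m) F i q) (\sum_(i < m) dF i).
Proof.
move=> h; have -> : (fun q => \sum_(i < m) F i q) = \sum_(i < m) F i.
  by apply/funext => q; rewrite fct_sumE.
exact: is_derive_sum.
Qed.

Lemma differentiable_edot w p : differentiable (fun q : V => edot (ycoord q) w) p.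
Proof.
have -> : (fun q : V => edot (ycoord q) w) =
    (fun q => \sum_(i < n) q 0 (rshift 1 i) * w 0 i).
  by apply/funext => q; rewrite edotE; apply: eq_bigr => i _; rewrite mxE.
apply: differentiable_bigsum => i.
by apply: differentiableM => //; exact: differentiable_coord.
Qed.

Lemma edot_is_derive w p v :
  is_derive p v (fun q : V => edot (ycoord q) w) (edot (ycoord v) w).
Proof.
have -> : (fun q : V => edot (ycoord q) w) =
    (fun q => \sum_(i < n) q 0 (rshift 1 i) * w 0 i).
  by apply/funext => q; rewrite edotE; apply: eq_bigr => i _; rewrite mxE.
have h i : is_derive p v (fun q : V => q 0 (rshift 1 i) * w 0 i)
    (v 0 (rshift 1 i) * w 0 i).
  apply: (is_derive_eq (is_derive_mul (coord_is_derive (rshift 1 i) p v)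
    (is_derive_const (w 0 i) p v))).
  by rewrite mulr0 add0r mulrC.
apply: (is_derive_eq (is_derive_bigsum h)).
by rewrite edotE; apply: eq_bigr => i _; rewrite mxE.
Qed.

Lemma differentiable_esq p : differentiable (fun q : V => esq (ycoord q)) p.
Proof.
have -> : (fun q : V => esq (ycoord q)) =
    (fun q => \sum_(i < n) q 0 (rshift 1 i) * q 0 (rshift 1 i)).
  by apply/funext => q; rewrite /esq edotE; apply: eq_bigr => i _; rewrite !mxE.
apply: differentiable_bigsum => i.
by apply: differentiableM => //; exact: differentiable_coord.
Qed.

Lemma esq_is_derive p v :
  is_derive p v (fun q : V => esq (ycoord q)) (2 * edot (ycoord p) (ycoord v)).
Proof.
have -> : (fun q : V => esq (ycoord q)) =
    (fun q => \sum_(i < n) q 0 (rshift 1 i) * q 0 (rshift 1 i)).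
  by apply/funext => q; rewrite /esq edotE; apply: eq_bigr => i _; rewrite !mxE.
have h i := is_derive_mul (coord_is_derive (rshift 1 i) p v)
  (coord_is_derive (rshift 1 i) p v).
apply: (is_derive_eq (is_derive_bigsum h)).
rewrite edotE mulr_sumr; apply: eq_bigr => i _; rewrite !mxE; ring.
Qed.

End EuclideanDerivatives.

(** * Smoothness of functions of [x] on [M] *)

Section RadialFunctions.
Context {R : realType} {n : nat}.
Variables (a b : R -> R) (x0 : R).
Hypothesis x0_gt0 : 0 < x0.
Hypothesis a_gt0 : forall x, 0 < x < x0 -> 0 < a x.
Hypothesis a_smooth : smooth_on `]0, x0[ a.
Hypothesis b_gt0 : forall x, 0 < b x.
Hypothesis b_end : b x0 = 1.
Hypothesis b_within : forall c, 0 < c <= x0 -> {within `[c, x0], continuous b}.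
Hypothesis db : forall x, 0 < x < x0 -> is_derive x 1 b (b x / a x).
Variables (C d : R).
Hypothesis d_gt0 : 0 < d.
Hypothesis a_asymp : forall x, 0 < x < d -> `|a x - x| <= C * x ^+ 2.

Local Notation V := 'rV[R]_(1 + n).
Local Notation X r := (radial_inv b x0 r).

Let XP := radial_invP x0_gt0 b_gt0 b_end b_within db d_gt0 a_asymp.
Let XK := radialK x0_gt0 a_gt0 b_gt0 b_end b_within db d_gt0 a_asymp.

(** On the line, [derive1n k] is the iterated directional derivative along [k] copies of [1], so
    [smooth_on] applies to it. *)
Lemma derive1n_is_derive k x : 0 < x < x0 ->
  is_derive x 1 (derive1n k a) (derive1n k.+1 a x).
Proof.
move=> hx; have e j : derive1n j a = Defs.iterD (nseq j (1 : R)) a.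
  elim: j => // j ih; rewrite derive1nS ih; apply/funext => y.
  by rewrite derive1E.
rewrite derive1nS derive1E; apply: DeriveDef => //.
apply: diff_derivable; rewrite e; apply: a_smooth.
by rewrite /= in_itv.
Qed.

Definition xcoord (p : V) : R := X (radius p).

Lemma xcoordP p : Mset p -> 0 < xcoord p < x0 /\ b (xcoord p) = radius p.
Proof.
by move=> /andP[h1 h2]; apply: XP; rewrite radius_gt0 radius_lt1 h1.
Qed.

(** Inverting [b ^+ 2] instead of [b] presents [x] as a function of [|y|^2], a polynomial in the
    coordinates, so no norm has to be differentiated. *)
Let sqrt_inv_is_derive x : 0 < x < x0 ->
  is_derive (b x ^+ 2) 1 (fun s => X (Num.sqrt s)) (2 * b x * (b x / a x))^-1.
Proof.
move=> hx; have near_x (P : R -> Prop) : (forall z, 0 < z < x0 -> P z) ->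
    \forall z \near x, P z.
  move=> hP; have : \forall z \near x, z \in `]0, x0[.
    by apply: near_in_itvoo; rewrite in_itv /=.
  by apply: filterS => z; rewrite in_itv /=; exact: hP.
have d2 z : 0 < z < x0 ->
    is_derive z 1 (fun x => b x ^+ 2) (2 * b z * (b z / a z)).
  move=> hz; have e : (fun x => b x ^+ 2) = (fun x => b x * b x).
    by apply/funext => y; rewrite expr2.
  rewrite e; apply: (is_derive_eq (is_derive_mul (db hz) (db hz))).
  by ring.
apply: (@is_derive_inverse R (fun x => b x ^+ 2)).
- by apply: near_x => z hz; rewrite sqrtr_sqr gtr0_norm// XK.
- by apply: near_x => z hz; exact: is_derive1_continuous (d2 z hz).
- exact: d2.
- by rewrite !mulf_neq0// ?invr_neq0// gt_eqF// a_gt0.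
Qed.

Lemma xcoord_differentiable p : Mset p -> differentiable xcoord p.
Proof.
move=> Mp; have [hx e] := xcoordP Mp.
have := sqrt_inv_is_derive hx; rewrite e sqr_enorm => h.
have -> : xcoord = (fun s => X (Num.sqrt s)) \o (fun q : V => esq (ycoord q)) by [].
apply: differentiable_comp; first exact: differentiable_esq.
by apply/derivable1_diffP; case: h.
Qed.

Lemma xcoord_is_derive p v : Mset p -> is_derive p v xcoord
  (a (xcoord p) * edot (ycoord p) (ycoord v) * (esq (ycoord p))^-1).
Proof.
move=> Mp; have [hx e] := xcoordP Mp.
have := sqrt_inv_is_derive hx; rewrite {1}e sqr_enorm => h.
have k := @is_derive_chain _ _ _ (fun q : V => esq (ycoord q)) _ _ _ _
  h (differentiable_esq p) (esq_is_derive p v).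
apply: (is_derive_eq k).
rewrite -sqr_enorm -/(radius p) -e.
have ax := a_gt0 hx; have bx := b_gt0 (xcoord p).
by field; rewrite !gt_eqF.
Qed.

(* Closed under every [D_v], since [D_v xcoord = a(xcoord) <y, v> / |y|^2]. *)
Inductive radial_algebra : (V -> R) -> Prop :=
| RACst c : radial_algebra (fun=> c)
| RADot w : radial_algebra (fun p => edot (ycoord p) w)
| RAInvEsq : radial_algebra (fun p => (esq (ycoord p))^-1)
| RADerive k : radial_algebra (fun p => derive1n k a (xcoord p))
| RAInv : radial_algebra (fun p => (a (xcoord p))^-1)
| RASin : radial_algebra (fun p => sin (xcoord p))
| RACos : radial_algebra (fun p => cos (xcoord p))
| RAAdd f g : radial_algebra f -> radial_algebra g ->
    radial_algebra (fun p => f p + g p)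
| RAMul f g : radial_algebra f -> radial_algebra g ->
    radial_algebra (fun p => f p * g p).

Let radial_algebra_chain phi dphi :
  (forall x, 0 < x < x0 -> is_derive x 1 phi (dphi x)) ->
  radial_algebra (fun p => dphi (xcoord p)) ->
  (forall p, Mset p -> differentiable (fun p => phi (xcoord p)) p) /\
  (forall v, exists2 g, radial_algebra g &
    forall p, Mset p -> is_derive p v (fun p => phi (xcoord p)) (g p)).
Proof.
move=> hphi hd; split=> [p Mp|v].
  apply: (@differentiable_comp _ _ _ _ xcoord phi); first exact: xcoord_differentiable.
  have [hx _] := xcoordP Mp.
  by apply/derivable1_diffP; case: (hphi _ hx).
(* Here [derive1n 0 a] stands for [a], so that [D_v xcoord] is literally a product of generators. *)
exists (fun p => dphi (xcoord p) *
   (derive1n 0 a (xcoord p) * edot (ycoord p) (ycoord v) * (esq (ycoord p))^-1)).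
  apply: RAMul => //; apply: RAMul; last exact: RAInvEsq.
  by apply: RAMul; [exact: RADerive|exact: RADot].
move=> p Mp; have [hx _] := xcoordP Mp.
exact: (@is_derive_chain _ _ phi xcoord) (hphi _ hx) (xcoord_differentiable Mp) (xcoord_is_derive v Mp).
Qed.

Lemma radial_algebra_derive f : radial_algebra f ->
  (forall p, Mset p -> differentiable f p) /\
  (forall v, exists2 g, radial_algebra g &
    forall p, Mset p -> is_derive p v f (g p)).
Proof.
elim=> {f} [c|w||k||||f g Af [df Df] Ag [dg Dg]|f g Af [df Df] Ag [dg Dg]].
- split=> [p _|v]; first exact: differentiable_cst.
  by exists (fun=> 0); [exact: RACst|move=> p _; exact: is_derive_const].
- split=> [p _|v]; first exact: differentiable_edot.
  exists (fun=> edot (ycoord v) w); first exact: RACst.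
  by move=> p _; exact: edot_is_derive.
- have nz (p : V) : Mset p -> esq (ycoord p) != 0 by move=> /andP[h _]; rewrite gt_eqF.
  split=> [p Mp|v].
    by apply: differentiableV; [exact: differentiable_esq|exact: nz].
  exists (fun p => -2 * (edot (ycoord p) (ycoord v) *
      ((esq (ycoord p))^-1 * (esq (ycoord p))^-1))).
    apply: RAMul; first exact: RACst.
    by apply: RAMul; [exact: RADot|apply: RAMul; exact: RAInvEsq].
  move=> p Mp; have p0 := nz _ Mp.
  have k : is_derive (esq (ycoord p)) 1 (fun s : R => s^-1) (- (esq (ycoord p)) ^- 2 *: 1).
    exact: (@is_deriveV _ id).
  apply: (is_derive_eq (@is_derive_chain _ _ _ (fun q : V => esq (ycoord q)) _ _ _ _
    k (differentiable_esq p) (esq_is_derive p v))).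
  by rewrite -[_ *: 1]/(_ * 1); field.
- apply: (@radial_algebra_chain (derive1n k a) (derive1n k.+1 a)).
    by move=> x hx; exact: derive1n_is_derive.
  exact: RADerive.
- apply: (@radial_algebra_chain (fun x => (a x)^-1)
    (* The derivative [- a' / a^2], spelt as a product of generators. *)
    (fun x => -1 * (derive1n 1 a x * ((a x)^-1 * (a x)^-1)))).
    move=> x hx; have ax := a_gt0 hx.
    have k : is_derive x 1 (fun s : R => (a s)^-1) (- (a x) ^- 2 *: derive1n 1 a x).
      by apply: is_deriveV; rewrite ?gt_eqF//; exact: (derive1n_is_derive 0 hx).
    apply: (is_derive_eq k); rewrite -[_ *: _]/(_ * _).
    by field; rewrite gt_eqF.
  apply: RAMul; first exact: RACst.
  by apply: RAMul; [exact: RADerive|apply: RAMul; exact: RAInv].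
- by apply: (@radial_algebra_chain sin cos); exact: RACos.
- apply: (@radial_algebra_chain cos (fun x => -1 * sin x)).
    by move=> x _; apply: (is_derive_eq (is_derive_cos x)); rewrite mulN1r.
  by apply: RAMul; [exact: RACst|exact: RASin].
- split=> [p Mp|v]; first by apply: differentiableD; [exact: df|exact: dg].
  have [f' Af' hf] := Df v; have [g' Ag' hg] := Dg v.
  exists (fun p => f' p + g' p); first exact: RAAdd.
  by move=> p Mp; exact: is_derive_add (hf p Mp) (hg p Mp).
- split=> [p Mp|v]; first by apply: differentiableM; [exact: df|exact: dg].
  have [f' Af' hf] := Df v; have [g' Ag' hg] := Dg v.
  exists (fun p => f p * g' p + g p * f' p).
    by apply: RAAdd; exact: RAMul.
  by move=> p Mp; exact: is_derive_mul (hf p Mp) (hg p Mp).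
Qed.

Lemma radial_algebra_smooth f : radial_algebra f -> smooth_on (@Mset R n) f.
Proof.
apply: smooth_on_closed_class; first exact: open_Mset.
  by move=> g /radial_algebra_derive[].
move=> g v /radial_algebra_derive[_ /(_ v)[g' Ag' hg']].
by exists g' => // p Mp; have [] := hg' p Mp.
Qed.

(** This is [Omega]: from [a = sqrt F * sin^2] one gets [1 / sqrt F = sin^2 / a], a form without
    square root that belongs to the algebra. *)
Lemma smooth_on_sin2_div : smooth_on (@Mset R n)
  (fun p => sin (xcoord p) ^+ 2 / a (xcoord p)).
Proof.
have -> : (fun p => sin (xcoord p) ^+ 2 / a (xcoord p)) =
    (fun p => (sin (xcoord p) * sin (xcoord p)) * (a (xcoord p))^-1).
  by apply/funext => p; rewrite expr2.
apply: radial_algebra_smooth; apply: RAMul; last exact: RAInv.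
by apply: RAMul; exact: RASin.
Qed.

End RadialFunctions.

(** * The metric [- dt^2 + h^2 |dy|^2] as a matrix *)

Section DiagonalMetric.
Context {R : realType} {n : nat}.
Local Notation V := 'rV[R]_(1 + n).

Definition warped_metric (h : R) : 'M[R]_(1 + n) :=
  diag_mx (\row_(i < 1 + n) (if val i == 0%N then -1 else h ^+ 2)).

Lemma pt_left (t : R) (y : 'rV[R]_n) : pt t y 0 (lshift n 0) = t.
Proof. by rewrite /pt row_mxEl mxE. Qed.

Lemma pt_right (t : R) (y : 'rV[R]_n) i : pt t y 0 (rshift 1 i) = y 0 i.
Proof. by rewrite /pt row_mxEr. Qed.

Lemma qform_warped h (tau : R) (y : 'rV[R]_n) :
  qform (warped_metric h) (pt tau y) = - tau ^+ 2 + h ^+ 2 * esq y.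
Proof.
move: (pt_left tau y) (pt_right tau y); move: (pt tau y) => v vl vr.
rewrite /qform /warped_metric mul_mx_diag mxE big_split_ord /= big_ord1.
congr (_ + _); first by rewrite !mxE /= vl; ring.
rewrite esqE mulr_sumr; apply: eq_bigr => i _.
by rewrite !mxE /= vr; ring.
Qed.

Lemma lorentzian_warped h : h != 0 -> lorentzian (warped_metric h).
Proof.
move=> h0; split; first by rewrite tr_diag_mx.
(* Index [0] is the time direction; every spatial axis is rescaled by [1 / h]. *)
exists (diag_mx (\row_(i < 1 + n) (if val i == 0%N then 1 else h^-1))).
  rewrite unitmxE det_diag unitfE; apply/prodf_neq0 => i _.
  by rewrite mxE; case: ifP => _; rewrite ?oner_neq0 ?invr_neq0.
rewrite tr_diag_mx !mulmx_diag; congr diag_mx; apply/rowP => i; rewrite !mxE.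
by case: ifP => _; [ring|field].
Qed.

Lemma warped_metricB g h :
  `|warped_metric g - warped_metric h| <= `|g ^+ 2 - h ^+ 2|.
Proof.
apply: mx_norm_le => // i j; rewrite !mxE.
have [->|_] := eqVneq i j; last by rewrite !mulr0n subrr normr0.
rewrite !mulr1n; case: ifP => _ //.
by rewrite subrr normr0.
Qed.

End DiagonalMetric.

(** * The axis [J] as a curve and as the boundary of [M] *)

Section CylinderGeometry.
Context {R : realType} {n : nat}.
Local Notation V := 'rV[R]_(1 + n).
Implicit Types p q : V.

Lemma ycoord_pt (t : R) (y : 'rV[R]_n) : ycoord (pt t y) = y.
Proof. by rewrite /ycoord /pt row_mxKr. Qed.

Lemma pt_lsubmx (t : R) (y : 'rV[R]_n) : lsubmx (pt t y) 0 0 = t.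
Proof. by rewrite /pt row_mxKl mxE. Qed.

Lemma pt_coords p : pt (lsubmx p 0 0) (ycoord p) = p.
Proof.
rewrite /pt -[RHS]hsubmxK; congr row_mx; apply/rowP => i.
by rewrite mxE ord1.
Qed.

Lemma Jset_radius p : Jset p <-> radius p = 0.
Proof.
split=> [h|/eqP]; first by rewrite /radius /enorm h esq0 sqrtr0.
rewrite /radius /enorm sqrtr_eq0 => h; apply/eqP.
by rewrite -esq_eq0 eq_le h esq_ge0.
Qed.

Lemma JcurveE : @Jcurve R n = (fun s : R => s *: pt 1 0 + 0).
Proof.
apply/funext => s; rewrite addr0 /Jcurve /pt scale_row_mx scaler0; congr row_mx.
by apply/rowP => i; rewrite !mxE mulr1.
Qed.

Lemma Jset_range : @Jset R n = range (@Jcurve R n).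
Proof.
apply/seteqP; split=> [p hp|_ [t _ <-]]; last by rewrite /Jset /= ycoord_pt.
by exists (lsubmx p 0 0) => //; rewrite -[RHS]pt_coords hp.
Qed.

Lemma smooth_Jcurve : smooth_on setT (@Jcurve R n).
Proof. by rewrite JcurveE; exact: smooth_affine. Qed.

Lemma derive1_Jcurve (t : R) : derive1 (@Jcurve R n) t = pt 1 0.
Proof. by rewrite derive1E JcurveE derive_affine scale1r. Qed.

Lemma connected_Jset : connected (@Jset R n).
Proof.
rewrite Jset_range; apply: connected_continuous_connected.
  by apply/connected_intervalP.
apply: continuous_subspaceT => t; apply: differentiable_continuous.
exact: (smooth_Jcurve [::] I).
Qed.

(** The time coordinate is 1-Lipschitz for the sup norm, so a limit point would confine [t] to a
    bounded interval. *)
Lemma inextendible_Jcurve (A : set V) : inextendible_in A (@Jcurve R n).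
Proof.
have key p t : `|p - Jcurve n t| <= 1 -> `|lsubmx p 0 0 - t| <= 1.
  apply: le_trans; rewrite -[X in _ - X](pt_lsubmx _ (0 : 'rV[R]_n)).
  by have := mx_coord_le (p - Jcurve n t) 0 (lshift n 0); rewrite !mxE.
move=> p _; split=> h.
  have h1 : \forall t \near +oo, `|p - Jcurve n t| <= 1.
    by move/cvgrPdist_le : h => /(_ 1 ltr01).
  have h2 : \forall t \near +oo, lsubmx p 0 0 + 1 < t by exact: nbhs_pinfty_gt (num_real _).
  have [t [/key k]] := filter_ex (filterI h1 h2).
  by move: k; rewrite ler_norml; lra.
have h1 : \forall t \near -oo, `|p - Jcurve n t| <= 1.
  by move/cvgrPdist_le : h => /(_ 1 ltr01).
have h2 : \forall t \near -oo, t < lsubmx p 0 0 - 1 by exact: nbhs_ninfty_lt (num_real _).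
have [t [/key k]] := filter_ex (filterI h1 h2).
by move: k; rewrite ler_norml; lra.
Qed.

(** A point of the axis is approached along a coordinate vector of [R^n], which exists because
    [0 < n]. *)
Lemma closure_Mset p : (0 < n)%N -> Mbar p ->
  (closure (@Mset R n) p /\ ~ Mset p) <-> Jset p.
Proof.
move=> n0 p1; split=> [[_ h]|hp].
  apply/eqP; rewrite -esq_eq0 eq_le esq_ge0 andbT leNgt.
  by apply/negP => h0; apply: h; rewrite /Mset /= h0.
have e0 : esq (ycoord p) = 0 by rewrite hp esq0.
split; last by rewrite /Mset /= e0 ltxx.
move=> B /nbhs_ballP[e /= e_gt0 hB].
pose u : 'rV[R]_n := delta_mx 0 (Ordinal n0).
have u1 : esq u = 1.
  rewrite esqE (bigD1 (Ordinal n0)) //= big1 ?mxE ?eqxx ?expr1n ?addr0// => i hi.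
  by rewrite mxE (negbTE hi) andbF expr0n.
(* [e / 2] keeps the point in the ball, [1/2] keeps it at radius below [1]. *)
pose s := Num.min (e / 2) 2^-1.
have s0 : 0 < s by rewrite lt_min divr_gt0//= invr_gt0.
have se : s <= e / 2 by rewrite ge_min lexx.
have sh : s <= 2^-1 by rewrite ge_min lexx orbT.
exists (pt (lsubmx p 0 0) (s *: u)); split.
  rewrite /Mset /= ycoord_pt esqZ u1 mulr1 exprn_gt0//= expr_lt1//; lra.
apply: hB; rewrite -ball_normE /= -{1}(pt_coords p) hp.
rewrite /pt opp_row_mx add_row_mx subrr sub0r.
apply: (@le_lt_trans _ _ s); last by lra.
apply: mx_norm_le => [|i j]; first exact: ltW.
rewrite -(splitK j); case: (fintype.split j) => k /=.
  by rewrite row_mxEl mxE normr0 ltW.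
rewrite row_mxEr !mxE normrN normrM (gtr0_norm s0) ler_piMr ?(ltW s0)//.
by case: (_ && _); rewrite ?normr1 ?normr0.
Qed.

End CylinderGeometry.

(** * The functions [r(x)], [F] and [a] up to [x0] *)

Section CoordinateFunctions.
Context {R : realType}.
Variables (f : R -> R) (x0 r1 : R).
Hypothesis x0_itv : 0 < x0 < pi / 2.
Hypothesis r1_lt : r1 < rfun x0.
Hypothesis f_smooth : smooth_on `]r1, +oo[ f.
Hypothesis f_gt0 : forall r, r1 < r -> 0 < f r.

(** [rfun] is the cotangent: [cos (x - pi / 2) = sin x] turns the derivative of [tan] into
    [1 / sin^2]. *)
Lemma rfun_is_derive x : 0 < x <= x0 ->
  is_derive x 1 (@rfun R) (- (sin x ^+ 2)^-1).
Proof.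
move=> hx; have sx : 0 < sin x by apply: sin_gt0_pihalf; have := x0_itv; lra.
have c : cos (x - pi / 2) = sin x by rewrite cosBpihalf.
have k : is_derive (x - pi / 2) 1 tan (sin x ^- 2).
  by rewrite -c; apply: is_derive_tan; rewrite c gt_eqF.
have k2 := is_derive_sub (is_derive_id x 1) (is_derive_const (pi / 2) x 1).
have k3 := @is_deriveN _ _ _ _ _ _ _ (@is_derive1_chain _ tan (fun x => x - pi / 2) _ _ _ k k2).
by apply: (is_derive_eq k3); rewrite subr0 mulr1.
Qed.

Lemma derive1_rfun x : 0 < x <= x0 -> derive1 (@rfun R) x = - (sin x ^+ 2)^-1.
Proof. by move=> hx; rewrite derive1E; have [] := rfun_is_derive hx. Qed.

(** [rfun] is nonincreasing, so its values stay above [rfun x0], inside the domain where [f] is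
    smooth and positive. *)
Lemma rfun_gt x : 0 < x <= x0 -> r1 < rfun x.
Proof.
move=> hx; apply: lt_le_trans r1_lt _; rewrite -lerN2.
have dN z : 0 < z <= x0 -> is_derive z 1 (fun z => - @rfun R z) (- - (sin z ^+ 2)^-1).
  by move=> hz; apply: is_deriveN (rfun_is_derive hz).
apply: (@is_derive1_le _ (fun z => - @rfun R z) (fun z => - - (sin z ^+ 2)^-1)).
- by case/andP: hx.
- by move=> z hz; apply: dN; lra.
- by move=> z _; rewrite opprK invr_ge0 sqr_ge0.
Qed.

Lemma Ffun_gt0 x : 0 < x <= x0 -> 0 < Ffun f x.
Proof. by move=> hx; apply/f_gt0/rfun_gt. Qed.

Lemma afun_gt0 x : 0 < x <= x0 -> 0 < afun f x.
Proof.
move=> hx; rewrite mulr_gt0 ?sqrtr_gt0 ?Ffun_gt0 ?exprn_gt0//.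
by apply: sin_gt0_pihalf; have := x0_itv; lra.
Qed.

(** The endpoint [x0] is reached through the smoothness of [f] beyond [rfun x0]; the integral
    defining [b] is taken up to there. *)
Lemma afun_continuous x : 0 < x <= x0 -> {for x, continuous (afun f)}.
Proof.
move=> hx; apply: (@continuousM _ _ (fun x => Num.sqrt (Ffun f x)) (fun x => sin x ^+ 2)).
  apply: (@continuous_comp _ _ _ (Ffun f) Num.sqrt); last exact: sqrt_continuous.
  apply: (@continuous_comp _ _ _ (@rfun R) f).
    exact: is_derive1_continuous (rfun_is_derive hx).
  apply: differentiable_continuous; apply: (f_smooth [::]).
  by rewrite /= in_itv /= andbT rfun_gt.
apply: (@continuous_comp _ _ _ sin (fun y => y ^+ 2)); first exact: continuous_sin.
exact: exprn_continuous.
Qed.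

End CoordinateFunctions.

(** * Polar coordinates, the metric identities and the profile *)

Section AdS2Ends.
Context {R : realType} {n : nat}.
Variables (f : R -> R) (x0 r1 : R).
Hypothesis x0_itv : 0 < x0 < pi / 2.
Hypothesis r1_lt : r1 < rfun x0.
Hypothesis f_smooth : smooth_on `]r1, +oo[ f.
Hypothesis f_gt0 : forall r, r1 < r -> 0 < f r.
Hypothesis a_smooth : smooth_on `]0, x0[ (afun f).
Variables (C d : R).
Hypothesis d_gt0 : 0 < d.
Hypothesis a_asymp : forall x, 0 < x < d ->
  `|afun f x - x| <= C * x ^+ 2 /\ `|derive1 (afun f) x - 1| <= C * x.

Local Notation V := 'rV[R]_(1 + n).
Local Notation a := (afun f).
Local Notation b := (bfun f x0).

Let x0_gt0 : 0 < x0. Proof. by case/andP: x0_itv. Qed.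

Let a_gt0 x : 0 < x < x0 -> 0 < a x.
Proof. by move=> hx; apply: (afun_gt0 x0_itv r1_lt f_gt0); lra. Qed.

Let b_gt0 x : 0 < b x. Proof. exact: expR_gt0. Qed.

Let a_gt0c x : 0 < x <= x0 -> 0 < a x.
Proof. exact: (afun_gt0 x0_itv r1_lt f_gt0). Qed.

Let a_contc x : 0 < x <= x0 -> {for x, continuous a}.
Proof. exact: (afun_continuous x0_itv r1_lt f_smooth). Qed.

Let b_end : b x0 = 1. Proof. exact: integral_factor_end. Qed.

Let b_within c : 0 < c <= x0 -> {within `[c, x0], continuous b}.
Proof. exact: integral_factor_within. Qed.

Let db x : 0 < x < x0 -> is_derive x 1 b (b x / a x).
Proof. exact: integral_factor_is_derive. Qed.

Let a_asymp0 x : 0 < x < d -> `|a x - x| <= C * x ^+ 2.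
Proof. by move=> /a_asymp[]. Qed.

Let bP x : 0 < x < x0 -> 0 < b x < 1.
Proof. exact: (radial_lt1 a_gt0 b_gt0 b_end b_within db). Qed.

Let b_inj x y : 0 < x < x0 -> 0 < y < x0 -> b x = b y -> x = y.
Proof. exact: (radial_inj a_gt0 b_gt0 b_within db). Qed.

Let XK := radialK x0_gt0 a_gt0 b_gt0 b_end b_within db d_gt0 a_asymp0.
Lemma xcoord_bfun (p : V) : Mset p ->
  0 < xcoord b x0 p < x0 /\ b (xcoord b x0 p) = radius p.
Proof. exact: (xcoordP x0_gt0 b_gt0 b_end b_within db d_gt0 a_asymp0). Qed.

Lemma radius_Phi t x (w : 'rV[R]_n) : esq w = 1 ->
  radius (Phi f x0 t x w) = b x.
Proof.
move=> hw; rewrite /radius /enorm ycoord_pt esqZ hw mulr1 sqrtr_sqr.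
by rewrite gtr0_norm.
Qed.

Lemma Mset_Phi (p : V) : Mset p <-> exists t x (w : 'rV[R]_n),
  [/\ 0 < x < x0, esq w = 1 & p = Phi f x0 t x w].
Proof.
split=> [Mp|[t [x [w [hx hw ->]]]]]; last first.
  by rewrite /Mset /= -radius_gt0 -radius_lt1 radius_Phi// bP.
have [hx e] := xcoord_bfun Mp.
have r0 : radius p != 0 by rewrite -e gt_eqF.
exists (lsubmx p 0 0), (xcoord b x0 p), ((radius p)^-1 *: ycoord p); split => //.
  by rewrite esqZ -sqr_enorm -/(radius p) exprVn mulVf// expf_neq0.
by rewrite /Phi e scalerA mulfV// scale1r pt_coords.
Qed.

Lemma Phi_inj t x (w : 'rV[R]_n) t' x' w' : 0 < x < x0 -> esq w = 1 ->
  0 < x' < x0 -> esq w' = 1 ->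
  Phi f x0 t x w = Phi f x0 t' x' w' -> [/\ t = t', x = x' & w = w'].
Proof.
move=> hx hw hx' hw' e.
have ex : x = x' by apply: b_inj => //; rewrite -(radius_Phi t x hw) e radius_Phi.
split=> //; first by rewrite -[LHS](pt_lsubmx t (b x *: w)) -/(Phi f x0 t x w) e pt_lsubmx.
have : ycoord (Phi f x0 t x w) = ycoord (Phi f x0 t' x' w') by rewrite e.
rewrite !ycoord_pt -ex => /scalerI; apply; rewrite gt_eqF//.
Qed.

(** Orthogonality of [eta] and [w] kills the cross term and [b] cancels; [a^2 = F sin^4] then gives
    [G^2 = sin^4 / a^4]. *)
Lemma dPhi_metric (h : R) t x (w : 'rV[R]_n) tau xi eta : 0 < x < x0 ->
  esq w = 1 -> edot eta w = 0 -> h = sin x ^+ 2 / (a x * b x) ->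
  qform (warped_metric h) (dPhi f x0 t x w tau xi eta) = gbar_coord f x tau xi eta.
Proof.
move=> hx hw he ->; rewrite qform_warped /gbar_coord; congr (_ + _).
have ax := a_gt0 hx; have bx := b_gt0 x.
have sx : 0 < sin x by apply: sin_gt0_pihalf; have := x0_itv; lra.
have Fx : 0 < Ffun f x by apply: (Ffun_gt0 x0_itv r1_lt f_gt0); lra.
have sF : a x ^+ 2 = Ffun f x * sin x ^+ 4.
  by rewrite exprMn sqr_sqrtr ?ltW//; ring.
have -> : derive1 b x = b x / a x by rewrite derive1E; have [_] := db hx.
rewrite esqD !esqZ edotZl edotZr edotC he hw /Gfun.
have aX4 : a x ^+ 4 = (Ffun f x * sin x ^+ 4) ^+ 2 by rewrite -sF; ring.
have -> : (sin x ^+ 2 / (a x * b x)) ^+ 2 *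
   ((b x / a x * xi) ^+ 2 * 1 + 2 * (b x / a x * xi * (b x * 0)) + b x ^+ 2 * esq eta)
   = sin x ^+ 4 * (xi ^+ 2 / a x ^+ 4 + esq eta / a x ^+ 2).
  by field; rewrite !gt_eqF.
by rewrite aX4 sF; field; rewrite !gt_eqF.
Qed.

(** With [dr/dx = - 1 / sin^2], it amounts to [G^2 = F^-2 sin^-4] and [G^2 a^2 = F^-1]. *)
Lemma gbar_conformal x tau xi (eta : 'rV[R]_n) : 0 < x < x0 ->
  gbar_coord f x tau xi eta = Omfun f x ^+ 2 * g_coord f x tau xi eta.
Proof.
move=> hx; have hx' : 0 < x <= x0 by lra.
have sx : 0 < sin x by apply: sin_gt0_pihalf; have := x0_itv; lra.
have Fx : 0 < Ffun f x by exact: (Ffun_gt0 x0_itv r1_lt f_gt0).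
rewrite /gbar_coord /g_coord (derive1_rfun x0_itv hx') /Omfun exprVn sqr_sqrtr ?(ltW Fx)//.
have -> : a x ^+ 2 = Ffun f x * sin x ^+ 4.
  by rewrite /afun exprMn sqr_sqrtr ?(ltW Fx)//; ring.
by rewrite /Gfun; field; rewrite !gt_eqF.
Qed.

Lemma sin2_div_afun x : 0 < x < x0 -> sin x ^+ 2 / a x = Omfun f x.
Proof.
move=> hx; have sx : 0 < sin x by apply: sin_gt0_pihalf; have := x0_itv; lra.
have Fx : 0 < Ffun f x by apply: (Ffun_gt0 x0_itv r1_lt f_gt0); lra.
have qx : 0 < Num.sqrt (Ffun f x) by rewrite sqrtr_gt0.
by rewrite /afun /Omfun; field; rewrite !gt_eqF.
Qed.

(** All the behaviour at the axis is condensed in [K], the extension of [ln h] as a function of the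
    radius. *)
Lemma conformal_profile : exists2 K : R -> R, lipschitz_below1 K &
  forall x, 0 < x < x0 -> expR (K (b x)) = sin x ^+ 2 / (a x * b x).
Proof.
have da x : 0 < x < x0 -> is_derive x 1 a (derive1 a x).
  by move=> hx; exact: (derive1n_is_derive a_smooth 0 hx).
have ca x : 0 < x < x0 -> {for x, continuous (derive1 a)}.
  by move=> hx; exact: is_derive1_continuous (derive1n_is_derive a_smooth 1 hx).
have [K hK K_lip] := lipschitz_below1_extend
  (radial_dominated_lipschitz x0_gt0 a_gt0 b_gt0 b_end b_within db d_gt0 a_asymp0
    (log_factor_is_derive x0_itv a_gt0 da b_gt0 db)
    (log_factor_dominated x0_itv a_gt0 da ca b_gt0 db d_gt0 a_asymp)).
exists K => // x hx; rewrite hK ?b_gt0// XK//.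
by rewrite (expR_log_factor x0_itv a_gt0 b_gt0).
Qed.

Lemma smooth_Omfun_xcoord :
  smooth_on (@Mset R n) (fun p => Omfun f (xcoord b x0 p)).
Proof.
apply: smooth_on_eq (smooth_on_sin2_div x0_gt0 a_gt0 a_smooth b_gt0 b_end
  b_within db d_gt0 a_asymp0); first exact: open_Mset.
by move=> p /xcoord_bfun[hx _]; exact: sin2_div_afun.
Qed.

End AdS2Ends.

Unset Implicit Arguments.

Theorem theoremB1 (R : realType) (n : nat) (f : R -> R) (x0 r1 : R) :
  (2 <= n)%N ->
  0 < x0 < pi / 2 ->
  (* f smooth and positive on an open r-interval containing [r(x0), +oo) *)
  r1 < rfun x0 ->
  smooth_on `]r1, +oo[ f ->
  (forall r, r1 < r -> 0 < f r) ->
  (* a smooth, a(x) = x + O(x^2), a'(x) = 1 + O(x) as x -> 0 *)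
  smooth_on `]0, x0[ (afun f) ->
  (exists C : R, exists2 d : R, 0 < d & forall x, 0 < x < d ->
      `| afun f x - x | <= C * x ^+ 2 /\
      `| derive1 (afun f) x - 1 | <= C * x) ->
  exists (gext : 'rV[R]_(1 + n) -> 'M[R]_(1 + n))
         (Omext : 'rV[R]_(1 + n) -> R),
  (
  (* (ii) y = b(x) w identifies M = R x (0,x0) x S^{n-1} with Mbar \ J *)
    (forall p : 'rV[R]_(1 + n), Mset p <-> exists t x (w : 'rV[R]_n),
        [/\ 0 < x < x0, esq w = 1 & p = Phi f x0 t x w]) /\
    (forall t x (w : 'rV[R]_n) t' x' w', 0 < x < x0 -> esq w = 1 ->
        0 < x' < x0 -> esq w' = 1 ->
        Phi f x0 t x w = Phi f x0 t' x' w' -> [/\ t = t', x = x' & w = w']) /\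
  (* gbar extends to a locally Lipschitz Lorentzian metric on Mbar *)
    (forall p, Mbar p -> lorentzian (gext p)) /\
    loc_lipschitz_on (@Mbar R n) gext /\
    (forall t x (w : 'rV[R]_n) tau xi eta, 0 < x < x0 -> esq w = 1 ->
        edot eta w = 0 ->
        qform (gext (Phi f x0 t x w)) (dPhi f x0 t x w tau xi eta)
        = gbar_coord f x tau xi eta) /\
  (* partial M = J, and J is a smooth inextendible timelike curve *)
    (forall p, Mbar p -> ((closure (@Mset R n) p /\ ~ Mset p) <-> Jset p)) /\
    ([/\ smooth_on setT (@Jcurve R n),
        (forall t, qform (gext (Jcurve n t)) (derive1 (@Jcurve R n) t) < 0) &
        inextendible_in (@Mbar R n) (@Jcurve R n)]) /\
  (* (iii) Omega extends continuously, vanishes on J, smooth positive on M,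
     d Omega bounded near J *)
    ({within @Mbar R n, continuous Omext} /\
        (forall p, Jset p -> Omext p = 0) /\
        (forall p, Mset p -> 0 < Omext p) /\
        smooth_on (@Mset R n) Omext /\
        (forall t x (w : 'rV[R]_n), 0 < x < x0 -> esq w = 1 ->
            Omext (Phi f x0 t x w) = Omfun f x) /\
        (forall p, Jset p -> exists2 U, nbhs p U &
            connected (U `&` @Jset R n) /\
            exists C : R, forall q, U q -> Mset q -> forall v,
              `| derive Omext q v | <= C * `| v |)) /\
  (* (iv) gbar = Omega^2 g on M *)
    (forall t x (w : 'rV[R]_n) tau xi eta, 0 < x < x0 -> esq w = 1 ->
        edot eta w = 0 ->
        gbar_coord f x tau xi eta
        = Omext (Phi f x0 t x w) ^+ 2 * g_coord f x tau xi eta)).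

Proof.
move=> n_ge2 x0_itv r1_lt f_smooth f_gt0 a_smooth [C [d d_gt0 a_asymp]].
have [K K_lip expK] := conformal_profile x0_itv r1_lt f_smooth f_gt0 a_smooth d_gt0 a_asymp.
have n_gt0 : (0 < n)%N by apply: leq_trans n_ge2.
have b_gt0 x : 0 < bfun f x0 x by exact: expR_gt0.
pose gext (p : 'rV[R]_(1 + n)) := @warped_metric R n (expR (K (radius p))).
(* [Omega = b * h] read in the variable [r = b x]; the factor [r] makes it vanish on [J]. *)
pose Kom r := r * expR (K r).
pose Omext (p : 'rV[R]_(1 + n)) := Kom (radius p).
have Kom_lip : lipschitz_below1 Kom.
  by apply: lipschitz_below1M; [exact: lipschitz_below1_id|exact: lipschitz_below1_expR].
have Om_Phi t x (w : 'rV[R]_n) : 0 < x < x0 -> esq w = 1 ->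
    Omext (Phi f x0 t x w) = Omfun f x.
  move=> hx hw; rewrite /Omext /Kom radius_Phi// expK//.
  rewrite -(sin2_div_afun x0_itv r1_lt f_gt0 hx).
  have ax : 0 < afun f x by apply: (afun_gt0 x0_itv r1_lt f_gt0); lra.
  by field; rewrite !gt_eqF.
have Om_lip := radial_lipschitz (n := n) Kom_lip.
(* [K] is only known to be Lipschitz, so smoothness is carried over from [Omfun f] of the coordinate
   [x], which agrees with [Omext] on [M]. *)
have Om_smooth : smooth_on (@Mset R n) Omext.
  have sm := smooth_Omfun_xcoord (n := n) x0_itv r1_lt f_smooth f_gt0 a_smooth d_gt0 a_asymp.
  apply: smooth_on_eq sm; first exact: open_Mset.
  move=> p Mp; have [hx e] := xcoord_bfun x0_itv r1_lt f_smooth f_gt0 d_gt0 a_asymp Mp.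
  rewrite /Omext /Kom -e expK// -(sin2_div_afun x0_itv r1_lt f_gt0 hx).
  have ax : 0 < afun f (xcoord (bfun f x0) x0 p).
    by apply: (afun_gt0 x0_itv r1_lt f_gt0); lra.
  by field; rewrite !gt_eqF.
exists gext, Omext.
split; first exact: (Mset_Phi x0_itv r1_lt f_smooth f_gt0 d_gt0 a_asymp).
split; first exact: (Phi_inj x0_itv r1_lt f_smooth f_gt0).
split; first by move=> p _; apply: lorentzian_warped; rewrite gt_eqF// expR_gt0.
split.
  apply: (@radial_loc_lipschitz _ _ _ gext) => r hr.
  have h2 := lipschitz_below1M (lipschitz_below1_expR K_lip) (lipschitz_below1_expR K_lip).
  have [L hL] := radial_lipschitz (n := n) h2 hr.
  exists L => p q hp hq; apply: le_trans (warped_metricB _ _) _.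
  by rewrite !expr2; exact: hL.
split.
  move=> t x w tau xi eta hx hw he.
  apply: (@dPhi_metric _ _ _ _ _ x0_itv r1_lt f_smooth f_gt0 _ t) => //.
  by rewrite radius_Phi// expK.
split; first by move=> p; exact: closure_Mset.
split.
  split; first exact: smooth_Jcurve.
    move=> t; rewrite derive1_Jcurve qform_warped esq0 mulr0 addr0 expr1n.
    by rewrite oppr_lt0 ltr01.
  exact: inextendible_Jcurve.
split; last first.
  move=> t x w tau xi eta hx hw _; rewrite Om_Phi//.
  exact: (gbar_conformal x0_itv r1_lt f_gt0).
split.
  apply: loc_lipschitz_within_continuous; apply: (@radial_loc_lipschitz _ _ _ Omext).
  exact: Om_lip.
split; first by move=> p /Jset_radius h; rewrite /Omext /Kom h mul0r.
split.
  move=> p /andP[h _]; rewrite /Omext /Kom mulr_gt0 ?expR_gt0//.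
  by rewrite radius_gt0.
split; first exact: Om_smooth.
split; first exact: Om_Phi.
(* This tube contains all of [J], hence meets it in a connected set, and stays away from radius [1],
   so a single Lipschitz constant bounds the differential. *)
move=> p hp; exists [set q | radius q < 2^-1].
  by apply: nbhs_radius_lt; move/Jset_radius: hp => ->; rewrite invr_gt0.
split.
  rewrite (_ : _ `&` _ = @Jset R n); first exact: connected_Jset.
  apply/seteqP; split=> [q []//|q hq]; split => //=.
  by move/Jset_radius: hq => ->; rewrite invr_gt0.
have [L hL] := Om_lip 2^-1 ltac:(lra).
exists L => q hq Mq v.
apply: (@lipschitz_derive_le _ _ _ _ _ _ _ [set q | radius q < 2^-1]).
- exact: nbhs_radius_lt.
- by move=> r /= hr; apply: hL; exact: ltW.
- by apply: diff_derivable; exact: (Om_smooth [::]).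
Qed.
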